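(* Let $\mathbb{K}$ be a field and let $0\to\mathfrak{a}\to\mathfrak{g}\overset{\tau}{\to}\mathfrak{h}\to0$ be an extension (short exact sequence) of Leibniz algebras over $\mathbb{K}$. Then there is an exact sequence $$HL_3(\mathfrak{g})\to HL_3(\mathfrak{h})\to\operatorname{Ker}\big(\theta_{\mathfrak{a},\mathfrak{g}}\colon\mathfrak{a}\curlywedge\mathfrak{g}\to\mathfrak{a}\big)\to HL_2(\mathfrak{g})\to HL_2(\mathfrak{h})\to\mathfrak{a}/[\mathfrak{a},\mathfrak{g}]\to HL_1(\mathfrak{g})\to HL_1(\mathfrak{h})\to0 .$$
   Context: $\mathbb{K}$ is a field; all vector spaces and algebras are over $\mathbb{K}$, and $\otimes=\otimes_{\mathbb{K}}$. A Leibniz algebra is a vector space $\mathfrak{g}$ with a bilinear bracket satisfying $[x,[y,z]]=[[x,y],z]-[[x,z],y]$. Homomorphisms are linear maps preserving the bracket. For ideals $\mathfrak{a},\mathfrak{b}$ of a Leibniz algebra, $[\mathfrak{a},\mathfrak{b}]$ is the linear span of all $[a,b]$ and $[b,a]$ with $a\in\mathfrak{a}$, $b\in\mathfrak{b}$. Leibniz homology: $HL_n(\mathfrak{g})$ is the $n$-th homology of the complex $CL_*(\mathfrak{g})$ with $CL_n(\mathfrak{g})=\mathfrak{g}^{\otimes n}$ ($CL_0=\mathbb{K}$), $d(x)=0$ for $x\in\mathfrak{g}$, and for $n>1$ $$d(x_1\otimes\cdots\otimes x_n)=\sum_{1\le i<j\le n}(-1)^j\, x_1\otimes\cdots\otimes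 x_{i-1}\otimes[x_i,x_j]\otimes x_{i+1}\otimes\cdots\otimes\widehat{x_j}\otimes\cdots\otimes x_n .$$ Non-abelian tensor and exterior product of ideals: let $\mathfrak{a},\mathfrak{b}$ be two-sided ideals of a Leibniz algebra. $\mathfrak{a}\star\mathfrak{b}$ is the Leibniz algebra generated by two formally distinct families of symbols $a*_1b$ and $b*_2a$ ($a\in\mathfrak{a}$, $b\in\mathfrak{b}$), both $\mathbb{K}$-bilinear in their arguments, subject to, for all $a,a'\in\mathfrak{a}$, $b,b'\in\mathfrak{b}$: $a*_1[b,b']=[a,b]*_1b'-[a,b']*_1b$; $b*_2[a,a']=[b,a]*_2a'-[b,a']*_2a$; $[a,a']*_1b=[a,b]*_2a'-a*_1[b,a']$; $[b,b']*_2a=[b,a]*_1b'-b*_2[a,b']$; $a*_1[a',b]=-a*_1[b,a']$; $b*_2[b',a]=-b*_2[a,b']$; $[a,b]*_1[a',b']=[a*_1b,\,a'*_1b']=[a,b]*_2[a',b']$; $[b,a]*_1[b',a']=[b*_2a,\,b'*_2a']=[b,a]*_2[b',a']$; $[a,b]*_1[b',a']=[a*_1b,\,b'*_2a']=[a,b]*_2[b',a']$; $[b,a]*_1[a',b']=[b*_2a,\,a'*_1b']=[b,a]*_2[a',b']$. The non-abelian exterior product $\mathfrak{a}\curlywedge\mathfrak{b}$ is the quotient of $\mathfrak{a}\star\mathfrak{b}$ by the (central) ideal spanned by all $c*_1c'-c*_2c'$ with $c,c'\in\mathfrak{a}\cap\mathfrak{b}$. The classes of $a*_1b$ and $b*_2a$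 are written $a\curlywedge b$ and $b\curlywedge a$. The Leibniz homomorphism $\theta_{\mathfrak{a},\mathfrak{b}}\colon\mathfrak{a}\curlywedge\mathfrak{b}\to\mathfrak{a}\cap\mathfrak{b}$ is given by $a\curlywedge b\mapsto[a,b]$, $b\curlywedge a\mapsto[b,a]$. Here $\mathfrak{a}$ and $\mathfrak{g}$ are regarded as ideals of $\mathfrak{g}$. The maps $HL_n(\mathfrak{g})\to HL_n(\mathfrak{h})$ are those induced by $\tau$. *)

(* Defs.v *)
From HB Require Import structures.
From mathcomp Require Import all_boot all_algebra.
From mathcomp Require Import boolp.
From mathcomp Require Import freeg.

Set Implicit Arguments.
Unset Strict Implicit.
Unset Printing Implicit Defensive.

Import GRing.Theory.
Local Open Scope ring_scope.
Local Open Scope quotient_scope.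

(* Subspaces are boolean predicates with a [submodClosed] structure; classical
   logic ([`[< P >]] is the truth value of [P]) makes this no restriction. *)

Section Subspace.
Variables (K : fieldType) (V : lmodType K).
Implicit Type S : submodClosed V.

Lemma submod_rpredN S x : x \in S -> - x \in S.
Proof. by move=> xS; rewrite -scaleN1r rpredZ. Qed.

Lemma submod_rpredB S x y : x \in S -> y \in S -> x - y \in S.
Proof. by move=> xS yS; rewrite rpredD ?submod_rpredN. Qed.

Definition subsp S := {x : V | x \in S}.

HB.instance Definition _ S := SubChoice.on (subsp S).
HB.instance Definition _ S := [SubChoice_isSubLmodule of subsp S by <:].

Definition span (P : V -> Prop) : {pred V} :=
  fun v => `[< exists2 s : seq (K * V),
                 (forall p, p \in s -> P p.2) & v = \sum_(p <- s) p.1 *: p.2 >].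

Lemma span_closed P : GRing.subsemimod_closed (span P).
Proof.
split; [split|].
- by apply/asboolP; exists [::]; rewrite ?big_nil.
- move=> u v /asboolP[s sP ->] /asboolP[t tP ->]; apply/asboolP.
  exists (s ++ t); last by rewrite big_cat.
  by move=> p; rewrite mem_cat => /orP[/sP|/tP].
- move=> c v /asboolP[s sP ->]; apply/asboolP.
  exists [seq (c * p.1, p.2) | p <- s]; first by move=> _ /mapP[p /sP ? ->].
  by rewrite big_map scaler_sumr; apply: eq_bigr => p _; rewrite scalerA.
Qed.
HB.instance Definition _ P := GRing.isSubmodClosed.Build K V (span P) (span_closed P).

Lemma mem_span (P : V -> Prop) v : P v -> v \in span P.
Proof.
move=> Pv; apply/asboolP; exists [:: (1, v)].
  by move=> p; rewrite inE => /eqP->.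
by rewrite big_seq1 scale1r.
Qed.

Lemma span_sub (P : V -> Prop) S :
  (forall v, P v -> v \in S) -> {subset span P <= S}.
Proof.
move=> PS v /asboolP[s sP ->]; rewrite big_seq.
by elim/big_ind: _ => [|x y|p /sP /PS]; [exact: rpred0|exact: rpredD|exact: rpredZ].
Qed.

End Subspace.

Section Quotient.
Variables (K : fieldType) (V : lmodType K) (S : submodClosed V).

Definition vquot_rel : rel V := fun x y => x - y \in S.

Lemma vquot_rel_equiv : equiv_class_of vquot_rel.
Proof.
rewrite /vquot_rel; split=> [x|x y|y x z]; first by rewrite subrr rpred0.
  by apply/idP/idP => /submod_rpredN; rewrite opprB.
by move=> xy yz; rewrite -[x](subrK y) -addrA rpredD.
Qed.
Canonical vquot_equiv := EquivRelPack vquot_rel_equiv.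
Canonical vquot_encModRel := defaultEncModRel vquot_rel.

Definition vquot := {eq_quot vquot_rel}.

HB.instance Definition _ : EqQuotient V vquot_rel vquot := EqQuotient.on vquot.
HB.instance Definition _ := Choice.on vquot.

Definition vpi : V -> vquot := \pi_vquot.

Lemma vpi_eqE x y : (vpi x == vpi y) = (x - y \in S).
Proof. by rewrite /vpi piE. Qed.

Lemma vpi_eqP x y : reflect (vpi x = vpi y) (x - y \in S).
Proof. by rewrite -vpi_eqE; apply: eqP. Qed.

Lemma repr_vpi x : repr (vpi x) - x \in S.
Proof. by apply/vpi_eqP; rewrite /vpi reprK. Qed.

Lemma vpi_repr (x : vquot) : vpi (repr x) = x.
Proof. by rewrite /vpi reprK. Qed.

Lemma vpiP (x : vquot) : exists v, x = vpi v.
Proof. by exists (repr x); rewrite vpi_repr. Qed.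

Let zero := vpi 0.
Let opp (x : vquot) := vpi (- repr x).
Let add (x y : vquot) := vpi (repr x + repr y).
Let scale (c : K) (x : vquot) := vpi (c *: repr x).

Let oppE x : opp (vpi x) = vpi (- x).
Proof. by apply/vpi_eqP; rewrite -opprD submod_rpredN // repr_vpi. Qed.
Let addE x y : add (vpi x) (vpi y) = vpi (x + y).
Proof. by apply/vpi_eqP; rewrite opprD addrACA rpredD ?repr_vpi. Qed.
Let scaleE c x : scale c (vpi x) = vpi (c *: x).
Proof. by apply/vpi_eqP; rewrite -scalerBr rpredZ ?repr_vpi. Qed.

Let addA : associative add.
Proof.
move=> x y z; have [[u ->] [v ->] [w ->]] := And3 (vpiP x) (vpiP y) (vpiP z).
by rewrite !addE addrA.
Qed.
Let addC : commutative add.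
Proof. by move=> x y; rewrite /add addrC. Qed.
Let add0 : left_id zero add.
Proof. by move=> x; have [u ->] := vpiP x; rewrite addE add0r. Qed.
Let addN : left_inverse zero opp add.
Proof. by move=> x; have [u ->] := vpiP x; rewrite oppE addE addNr. Qed.

HB.instance Definition _ := GRing.isZmodule.Build vquot addA addC add0 addN.

Let scaleA a b x : scale a (scale b x) = scale (a * b) x.
Proof. by have [u ->] := vpiP x; rewrite !scaleE scalerA. Qed.
Let scale1 : left_id 1 scale.
Proof. by move=> x; have [u ->] := vpiP x; rewrite scaleE scale1r. Qed.
Let scaleDr : right_distributive scale add.
Proof.
move=> a x y; have [[u ->] [v ->]] := conj (vpiP x) (vpiP y).
by rewrite addE !scaleE addE scalerDr.
Qed.
Let scaleDl x : {morph scale^~ x : a b / a + b >-> add a b}.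
Proof.
by move=> a b; have [u ->] := vpiP x; rewrite !scaleE addE scalerDl.
Qed.

HB.instance Definition _ :=
  GRing.Zmodule_isLmodule.Build K vquot scaleA scale1 scaleDr scaleDl.

Lemma vpi_is_linear : linear vpi.
Proof.
move=> c x y; change (vpi (c *: x + y) = add (scale c (vpi x)) (vpi y)).
by rewrite scaleE addE.
Qed.
HB.instance Definition _ := GRing.isLinear.Build K V vquot *:%R vpi vpi_is_linear.

Lemma vpi_eq0 x : (vpi x == 0) = (x \in S).
Proof. by rewrite -(linear0 vpi) vpi_eqE subr0. Qed.

Section Lift.
Variables (W : lmodType K) (f : {linear V -> W}).

Definition vlift of (forall x, x \in S -> f x = 0) : vquot -> W :=
  fun x => f (repr x).

Variable fS : forall x, x \in S -> f x = 0.

Lemma vlift_pi x : vlift fS (vpi x) = f x.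
Proof. by apply/eqP; rewrite -subr_eq0 -linearB fS ?repr_vpi. Qed.

Lemma vlift_is_linear : linear (vlift fS).
Proof.
move=> c x y; have [[u ->] [v ->]] := conj (vpiP x) (vpiP y).
by rewrite -linearP !vlift_pi linearP.
Qed.
HB.instance Definition _ :=
  GRing.isLinear.Build K vquot W *:%R (vlift fS) vlift_is_linear.
End Lift.

End Quotient.

Section LinearMaps.
Variables (K : fieldType) (V W : lmodType K) (f : {linear V -> W}).

Definition lkern : {pred V} := fun v => f v == 0.
Lemma lkern_closed : GRing.subsemimod_closed lkern.
Proof.
split; [split|]; first exact/eqP/linear0.
  by move=> u v /eqP u0 /eqP v0; apply/eqP; rewrite linearD u0 v0 addr0.
by move=> c u /eqP u0; apply/eqP; rewrite linearZ u0 /= scaler0.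
Qed.
HB.instance Definition _ := GRing.isSubmodClosed.Build K V lkern lkern_closed.

Definition limage : {pred W} := fun w => `[< exists v, f v = w >].
Lemma limage_closed : GRing.subsemimod_closed limage.
Proof.
split; [split|].
- by apply/asboolP; exists 0; rewrite linear0.
- move=> _ _ /asboolP[u <-] /asboolP[v <-]; apply/asboolP.
  by exists (u + v); rewrite linearD.
- by move=> c _ /asboolP[u <-]; apply/asboolP; exists (c *: u); rewrite linearZ.
Qed.
HB.instance Definition _ := GRing.isSubmodClosed.Build K W limage limage_closed.

Variable S : submodClosed W.
Definition lpreim : {pred V} := fun v => f v \in S.
Lemma lpreim_closed : GRing.subsemimod_closed lpreim.
Proof.
split; [split|]; first by rewrite unfold_in /lpreim linear0 rpred0.
  by move=> u v uS vS; rewrite unfold_in /lpreim linearD rpredD.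
by move=> c u uS; rewrite unfold_in /lpreim linearZ rpredZ.
Qed.
HB.instance Definition _ := GRing.isSubmodClosed.Build K V lpreim lpreim_closed.

End LinearMaps.

Notation ker f := (subsp (lkern f)).

Reserved Notation "⁅ x , y ⁆" (at level 0, format "⁅ x ,  y ⁆").

HB.mixin Record isLeibniz (K : fieldType) L of GRing.Lmodule K L := {
  lbr : L -> L -> L;
  lbr_linearl : forall z, linear (lbr^~ z);
  lbr_linearr : forall x, linear (lbr x);
  lbr_leibniz : forall x y z,
    lbr x (lbr y z) = lbr (lbr x y) z - lbr (lbr x z) y
}.

#[short(type="leibnizType")]
HB.structure Definition Leibniz (K : fieldType) :=
  {L of GRing.Lmodule K L & isLeibniz K L}.

Notation "⁅ x , y ⁆" := (lbr x y) : ring_scope.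

HB.mixin Record isLeibnizHom (K : fieldType) (g h : leibnizType K)
    (f : g -> h) := {
  lbr_morph : {morph f : x y / ⁅x, y⁆ >-> ⁅x, y⁆}
}.

#[short(type="leibnizHom")]
HB.structure Definition LeibnizHom (K : fieldType) (g h : leibnizType K) :=
  {f of @GRing.Linear K g h *:%R f & isLeibnizHom K g h f}.

Notation "{ 'leibniz' g -> h }" := (@LeibnizHom.type _ g h)
  (at level 0, g at level 98, h at level 99, format "{ 'leibniz'  g  ->  h }")
  : type_scope.

HB.mixin Record isLeibnizIdeal (K : fieldType) (g : leibnizType K)
    (I : g -> bool) := {
  lbr_ideall : forall x y, x \in I -> ⁅x, y⁆ \in I;
  lbr_idealr : forall x y, y \in I -> ⁅x, y⁆ \in I
}.

#[short(type="leibnizIdeal")]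
HB.structure Definition LeibnizIdeal (K : fieldType) (g : leibnizType K) :=
  {I of @GRing.SubmodClosed K g I & isLeibnizIdeal K g I}.

Section LeibnizTheory.
Variables (K : fieldType) (g : leibnizType K).
Implicit Types x y z : g.

HB.instance Definition _ x :=
  GRing.isLinear.Build K g g *:%R (lbr x) (lbr_linearr x).

Lemma lbrDl x y z : ⁅x + y, z⁆ = ⁅x, z⁆ + ⁅y, z⁆.
Proof. by have := lbr_linearl z 1 x y; rewrite !scale1r. Qed.
Lemma lbrDr x y z : ⁅x, y + z⁆ = ⁅x, y⁆ + ⁅x, z⁆.
Proof. exact: linearD. Qed.
Lemma lbr0l z : ⁅0, z⁆ = 0 :> g.
Proof. by apply: (addrI ⁅0, z⁆); rewrite -lbrDl !addr0. Qed.
Lemma lbr0r x : ⁅x, 0⁆ = 0 :> g.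
Proof. exact: linear0. Qed.
Lemma lbrZl c x z : ⁅c *: x, z⁆ = c *: ⁅x, z⁆.
Proof. by have := lbr_linearl z c x 0; rewrite lbr0l !addr0. Qed.
Lemma lbrZr c x y : ⁅x, c *: y⁆ = c *: ⁅x, y⁆.
Proof. exact: linearZ. Qed.
Lemma lbrNl x y : ⁅- x, y⁆ = - ⁅x, y⁆.
Proof. by rewrite -!scaleN1r lbrZl. Qed.
Lemma lbrNr x y : ⁅x, - y⁆ = - ⁅x, y⁆.
Proof. exact: linearN. Qed.
Lemma lbrBl x y z : ⁅x - y, z⁆ = ⁅x, z⁆ - ⁅y, z⁆.
Proof. by rewrite lbrDl lbrNl. Qed.
Lemma lbrBr x y z : ⁅x, y - z⁆ = ⁅x, y⁆ - ⁅x, z⁆.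
Proof. exact: linearB. Qed.

End LeibnizTheory.

Section IdealAlgebra.
Variables (K : fieldType) (g : leibnizType K) (I : leibnizIdeal g).

Definition ibrl (x : subsp I) (y : g) : subsp I :=
  exist _ ⁅val x, y⁆ (lbr_ideall (val x) y (valP x)).
Definition ibrr (x : g) (y : subsp I) : subsp I :=
  exist _ ⁅x, val y⁆ (lbr_idealr x (val y) (valP y)).

Let br (x y : subsp I) := ibrl x (val y).
Fact ideal_linearl z : linear (br^~ z).
Proof. by move=> c x y; apply/val_inj; rewrite /= lbrDl lbrZl. Qed.
Fact ideal_linearr x : linear (br x).
Proof. by move=> c y z; apply/val_inj; rewrite /= lbrDr lbrZr. Qed.
Fact ideal_leibniz x y z : br x (br y z) = br (br x y) z - br (br x z) y.
Proof. by apply/val_inj; rewrite /= lbr_leibniz. Qed.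
HB.instance Definition _ :=
  isLeibniz.Build K (subsp I) ideal_linearl ideal_linearr ideal_leibniz.

End IdealAlgebra.

Section QuotientAlgebra.
Variables (K : fieldType) (g : leibnizType K) (I : leibnizIdeal g).

Let br (x y : vquot I) : vquot I := vpi I ⁅repr x, repr y⁆.
Let brE x y : br (vpi I x) (vpi I y) = vpi I ⁅x, y⁆.
Proof.
apply/vpi_eqP; set u := repr _; set v := repr _.
rewrite -(subrK ⁅x, v⁆ ⁅u, v⁆) -addrA -lbrBl -lbrBr.
by apply: rpredD; [apply: lbr_ideall | apply: lbr_idealr]; apply: repr_vpi.
Qed.
Fact vquot_linearl z : linear (br^~ z).
Proof.
move=> c x y; have [[u ->] [v ->] [w ->]] := And3 (vpiP x) (vpiP y) (vpiP z).
by rewrite -linearP !brE -linearP lbrDl lbrZl.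
Qed.
Fact vquot_linearr x : linear (br x).
Proof.
move=> c y z; have [[u ->] [v ->] [w ->]] := And3 (vpiP x) (vpiP y) (vpiP z).
by rewrite -linearP !brE -linearP lbrDr lbrZr.
Qed.
Fact vquot_leibniz x y z : br x (br y z) = br (br x y) z - br (br x z) y.
Proof.
have [[u ->] [v ->] [w ->]] := And3 (vpiP x) (vpiP y) (vpiP z).
by rewrite !brE -linearB lbr_leibniz.
Qed.
HB.instance Definition _ :=
  isLeibniz.Build K (vquot I) vquot_linearl vquot_linearr vquot_leibniz.

Fact vpi_lbr : {morph vpi I : x y / ⁅x, y⁆ >-> ⁅x, y⁆}.
Proof. by move=> x y; rewrite -brE. Qed.
HB.instance Definition _ := isLeibnizHom.Build K g (vquot I) (vpi I) vpi_lbr.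

End QuotientAlgebra.

Section Ideals.
Variables (K : fieldType) (g : leibnizType K).

Definition fullp : {pred g} := fun=> true.
Fact fullp_closed : GRing.subsemimod_closed fullp. Proof. by []. Qed.
HB.instance Definition _ :=
  GRing.isSubmodClosed.Build K g fullp fullp_closed.
Fact fullp_ideal (x y : g) : y \in fullp -> ⁅x, y⁆ \in fullp. Proof. by []. Qed.
Fact fullp_ideal' (x y : g) : x \in fullp -> ⁅x, y⁆ \in fullp. Proof. by []. Qed.
HB.instance Definition _ :=
  isLeibnizIdeal.Build K g fullp fullp_ideal' fullp_ideal.

Variables A B : leibnizIdeal g.

Definition meetp : {pred g} := fun x => (x \in A) && (x \in B).
Fact meetp_closed : GRing.subsemimod_closed meetp.
Proof.
split; [split|]; rewrite /meetp.
- by rewrite unfold_in !rpred0.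
- by move=> x y /andP[xA xB] /andP[yA yB]; rewrite unfold_in !rpredD.
- by move=> c x /andP[xA xB]; rewrite unfold_in !rpredZ.
Qed.
HB.instance Definition _ :=
  GRing.isSubmodClosed.Build K g meetp meetp_closed.
Fact meetp_ideall (x y : g) : x \in meetp -> ⁅x, y⁆ \in meetp.
Proof. by move=> /andP[xA xB]; rewrite unfold_in /meetp !lbr_ideall. Qed.
Fact meetp_idealr (x y : g) : y \in meetp -> ⁅x, y⁆ \in meetp.
Proof. by move=> /andP[xA xB]; rewrite unfold_in /meetp !lbr_idealr. Qed.
HB.instance Definition _ :=
  isLeibnizIdeal.Build K g meetp meetp_ideall meetp_idealr.

Definition commp : {pred g} :=
  span (fun z => exists x y, [/\ x \in A, y \in B & z = ⁅x, y⁆ \/ z = ⁅y, x⁆]).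
HB.instance Definition _ := GRing.SubmodClosed.on commp.

End Ideals.

Arguments fullp {K} g _.

Section Presentation.
Variables (K : fieldType) (G : Type).

Inductive lterm :=
| LGen of G | LZero | LAdd of lterm & lterm | LScale of K & lterm
| LBr of lterm & lterm.

HB.instance Definition _ := gen_eqMixin lterm.
HB.instance Definition _ := gen_choiceMixin lterm.

Definition LOpp := LScale (-1).
Definition LSub s t := LAdd s (LOpp t).

Variable R : lterm -> lterm -> Prop.

Inductive lcong : lterm -> lterm -> Prop :=
| lcong_rel s t : R s t -> lcong s t
| lcong_refl s : lcong s s
| lcong_sym s t : lcong s t -> lcong t s
| lcong_trans s t u : lcong s t -> lcong t u -> lcong s u
| lcong_add s s' t t' : lcong s s' -> lcong t t' -> lcong (LAdd s t) (LAdd s' t')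
| lcong_scale c s s' : lcong s s' -> lcong (LScale c s) (LScale c s')
| lcong_br s s' t t' : lcong s s' -> lcong t t' -> lcong (LBr s t) (LBr s' t')
| lcong_addA s t u : lcong (LAdd s (LAdd t u)) (LAdd (LAdd s t) u)
| lcong_addC s t : lcong (LAdd s t) (LAdd t s)
| lcong_add0 s : lcong (LAdd LZero s) s
| lcong_addN s : lcong (LAdd (LOpp s) s) LZero
| lcong_scaleA c d s : lcong (LScale c (LScale d s)) (LScale (c * d) s)
| lcong_scale1 s : lcong (LScale 1 s) s
| lcong_scaleDr c s t : lcong (LScale c (LAdd s t)) (LAdd (LScale c s) (LScale c t))
| lcong_scaleDl c d s : lcong (LScale (c + d) s) (LAdd (LScale c s) (LScale d s))
| lcong_brl c s t u :
    lcong (LBr (LAdd (LScale c s) t) u) (LAdd (LScale c (LBr s u)) (LBr t u))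
| lcong_brr c s t u :
    lcong (LBr s (LAdd (LScale c t) u)) (LAdd (LScale c (LBr s t)) (LBr s u))
| lcong_leibniz s t u :
    lcong (LBr s (LBr t u)) (LSub (LBr (LBr s t) u) (LBr (LBr s u) t)).

Definition lcongb : rel lterm := fun s t => `[< lcong s t >].

Lemma lcongb_equiv : equiv_class_of lcongb.
Proof.
split=> [s|s t|t s u]; first exact/asboolP/lcong_refl.
  by apply/idP/idP => /asboolP st; apply/asboolP/lcong_sym.
by move=> /asboolP st /asboolP tu; apply/asboolP/lcong_trans/tu.
Qed.
Canonical lcong_equiv := EquivRelPack lcongb_equiv.
Canonical lcong_encModRel := defaultEncModRel lcongb.

(* The Leibniz algebra presented by the generators [G] and the relations [R]. *)
Definition lpres := {eq_quot lcongb}.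

HB.instance Definition _ : EqQuotient lterm lcongb lpres := EqQuotient.on lpres.
HB.instance Definition _ := Choice.on lpres.

Definition lpi : lterm -> lpres := \pi_lpres.

Lemma lpi_eqP s t : lpi s = lpi t <-> lcong s t.
Proof.
rewrite /lpi; split=> [/eqP|st]; first by rewrite piE => /asboolP.
by apply/eqP; rewrite piE; apply/asboolP.
Qed.

Lemma lpi_repr (x : lpres) : lpi (repr x) = x.
Proof. by rewrite /lpi reprK. Qed.

Lemma lpiP (x : lpres) : exists s, x = lpi s.
Proof. by exists (repr x); rewrite lpi_repr. Qed.

Lemma repr_lpi s : lcong (repr (lpi s)) s.
Proof. by apply/lpi_eqP; rewrite lpi_repr. Qed.

Let zero := lpi LZero.
Let add (x y : lpres) := lpi (LAdd (repr x) (repr y)).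
Let opp (x : lpres) := lpi (LOpp (repr x)).
Let scale c (x : lpres) := lpi (LScale c (repr x)).
Let br (x y : lpres) := lpi (LBr (repr x) (repr y)).

Let addE s t : add (lpi s) (lpi t) = lpi (LAdd s t).
Proof. by apply/lpi_eqP/lcong_add; apply: repr_lpi. Qed.
Let oppE s : opp (lpi s) = lpi (LOpp s).
Proof. by apply/lpi_eqP/lcong_scale; apply: repr_lpi. Qed.
Let scaleE c s : scale c (lpi s) = lpi (LScale c s).
Proof. by apply/lpi_eqP/lcong_scale; apply: repr_lpi. Qed.
Let brE s t : br (lpi s) (lpi t) = lpi (LBr s t).
Proof. by apply/lpi_eqP/lcong_br; apply: repr_lpi. Qed.

Let addA : associative add.
Proof.
move=> x y z; have [[s ->] [t ->] [u ->]] := And3 (lpiP x) (lpiP y) (lpiP z).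
by rewrite !addE; apply/lpi_eqP/lcong_addA.
Qed.
Let addC : commutative add.
Proof. by move=> x y; apply/lpi_eqP/lcong_addC. Qed.
Let add0 : left_id zero add.
Proof.
by move=> x; have [s ->] := lpiP x; rewrite addE; apply/lpi_eqP/lcong_add0.
Qed.
Let addN : left_inverse zero opp add.
Proof.
move=> x; have [s ->] := lpiP x.
by rewrite oppE addE; apply/lpi_eqP/lcong_addN.
Qed.
HB.instance Definition _ := GRing.isZmodule.Build lpres addA addC add0 addN.

Let scaleA a b x : scale a (scale b x) = scale (a * b) x.
Proof.
by have [s ->] := lpiP x; rewrite !scaleE; apply/lpi_eqP/lcong_scaleA.
Qed.
Let scale1 : left_id 1 scale.
Proof.
by move=> x; have [s ->] := lpiP x; rewrite scaleE; apply/lpi_eqP/lcong_scale1.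
Qed.
Let scaleDr : right_distributive scale add.
Proof.
move=> a x y; have [[s ->] [t ->]] := conj (lpiP x) (lpiP y).
by rewrite addE !scaleE addE; apply/lpi_eqP/lcong_scaleDr.
Qed.
Let scaleDl x : {morph scale^~ x : a b / a + b >-> add a b}.
Proof.
move=> a b; have [s ->] := lpiP x.
by rewrite !scaleE addE; apply/lpi_eqP/lcong_scaleDl.
Qed.
HB.instance Definition _ :=
  GRing.Zmodule_isLmodule.Build K lpres scaleA scale1 scaleDr scaleDl.

Lemma lpiD s t : lpi (LAdd s t) = lpi s + lpi t.
Proof. by rewrite -addE. Qed.
Lemma lpi0 : lpi LZero = 0. Proof. by []. Qed.
Lemma lpiZ c s : lpi (LScale c s) = c *: lpi s.
Proof. by rewrite -scaleE. Qed.
Lemma lpiB s t : lpi (LSub s t) = lpi s - lpi t.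
Proof. by rewrite lpiD lpiZ scaleN1r. Qed.

Let br_linearl z : linear (br^~ z).
Proof.
move=> c x y; have [[s ->] [t ->] [u ->]] := And3 (lpiP x) (lpiP y) (lpiP z).
by rewrite -lpiZ -lpiD !brE -lpiZ -lpiD; apply/lpi_eqP/lcong_brl.
Qed.
Let br_linearr x : linear (br x).
Proof.
move=> c y z; have [[s ->] [t ->] [u ->]] := And3 (lpiP x) (lpiP y) (lpiP z).
by rewrite -lpiZ -lpiD !brE -lpiZ -lpiD; apply/lpi_eqP/lcong_brr.
Qed.
Let br_leibniz x y z : br x (br y z) = br (br x y) z - br (br x z) y.
Proof.
have [[s ->] [t ->] [u ->]] := And3 (lpiP x) (lpiP y) (lpiP z).
by rewrite !brE -lpiB; apply/lpi_eqP/lcong_leibniz.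
Qed.
HB.instance Definition _ :=
  isLeibniz.Build K lpres br_linearl br_linearr br_leibniz.

Lemma lpi_br s t : lpi (LBr s t) = ⁅lpi s, lpi t⁆.
Proof. by rewrite -brE. Qed.

Definition lgen (x : G) : lpres := lpi (LGen x).

Section Lift.
Variables (L : leibnizType K) (f : G -> L).

Fixpoint leval (s : lterm) : L :=
  match s with
  | LGen x => f x
  | LZero => 0
  | LAdd s t => leval s + leval t
  | LScale c s => c *: leval s
  | LBr s t => ⁅leval s, leval t⁆
  end.

Definition llift of (forall s t, R s t -> leval s = leval t) : lpres -> L :=
  fun x => leval (repr x).

Variable fR : forall s t, R s t -> leval s = leval t.

Lemma leval_cong s t : lcong s t -> leval s = leval t.
Proof.
elim=> //=.
- by move=> s' t' u _ -> _ ->.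
- by move=> s1 s2 t1 t2 _ -> _ ->.
- by move=> c s1 s2 _ ->.
- by move=> s1 s2 t1 t2 _ -> _ ->.
- by move=> *; rewrite addrA.
- by move=> *; rewrite addrC.
- by move=> *; rewrite add0r.
- by move=> *; rewrite scaleN1r addNr.
- by move=> *; rewrite scalerA.
- by move=> *; rewrite scale1r.
- by move=> *; rewrite scalerDr.
- by move=> *; rewrite scalerDl.
- by move=> *; rewrite lbrDl lbrZl.
- by move=> *; rewrite lbrDr lbrZr.
- by move=> *; rewrite lbr_leibniz scaleN1r.
Qed.

Lemma llift_pi s : llift fR (lpi s) = leval s.
Proof. exact/leval_cong/repr_lpi. Qed.

Lemma llift_gen x : llift fR (lgen x) = f x.
Proof. exact: llift_pi. Qed.

Fact llift_is_linear : linear (llift fR).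
Proof.
move=> c x y; have [[s ->] [t ->]] := conj (lpiP x) (lpiP y).
by rewrite -lpiZ -lpiD !llift_pi.
Qed.
HB.instance Definition _ :=
  GRing.isLinear.Build K lpres L *:%R (llift fR) llift_is_linear.
Fact llift_lbr : {morph llift fR : x y / ⁅x, y⁆ >-> ⁅x, y⁆}.
Proof.
move=> x y; have [[s ->] [t ->]] := conj (lpiP x) (lpiP y).
by rewrite -lpi_br !llift_pi.
Qed.
HB.instance Definition _ := isLeibnizHom.Build K lpres L (llift fR) llift_lbr.
End Lift.

End Presentation.

Section ExteriorProduct.
Variables (K : fieldType) (g : leibnizType K) (A B : leibnizIdeal g).
Implicit Types (a : subsp A) (b : subsp B).

Inductive star_gen := Star1 of subsp A & subsp B | Star2 of subsp B & subsp A.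

Local Notation term := (lterm K star_gen).
Local Notation "a *1 b" := (LGen K (Star1 a b)) (at level 38).
Local Notation "b *2 a" := (LGen K (Star2 b a)) (at level 38).
Local Notation "s [-] t" := (LSub s t) (at level 50).

(* For a in A and b in B, [a, b] lies in both ideals: [ibrl a (val b)] is the
   bracket as an element of A, [ibrr (val a) b] the same as an element of B. *)
Inductive star_rel : term -> term -> Prop :=
| star1_linearl c a a' b :
    star_rel ((c *: a + a') *1 b) (LAdd (LScale c (a *1 b)) (a' *1 b))
| star1_linearr c a b b' :
    star_rel (a *1 (c *: b + b')) (LAdd (LScale c (a *1 b)) (a *1 b'))
| star2_linearl c b b' a :
    star_rel ((c *: b + b') *2 a) (LAdd (LScale c (b *2 a)) (b' *2 a))
| star2_linearr c b a a' :
    star_rel (b *2 (c *: a + a')) (LAdd (LScale c (b *2 a)) (b *2 a'))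
| star_1r a b b' :
    star_rel (a *1 ⁅b, b'⁆)
             (ibrl a (val b) *1 b' [-] ibrl a (val b') *1 b)
| star_2r b a a' :
    star_rel (b *2 ⁅a, a'⁆)
             (ibrl b (val a) *2 a' [-] ibrl b (val a') *2 a)
| star_1l a a' b :
    star_rel (⁅a, a'⁆ *1 b)
             (ibrr (val a) b *2 a' [-] a *1 ibrl b (val a'))
| star_2l b b' a :
    star_rel (⁅b, b'⁆ *2 a)
             (ibrr (val b) a *1 b' [-] b *2 ibrl a (val b'))
| star_1N a a' b :
    star_rel (a *1 ibrr (val a') b) (LOpp (a *1 ibrl b (val a')))
| star_2N b b' a :
    star_rel (b *2 ibrr (val b') a) (LOpp (b *2 ibrl a (val b')))
| star_11_1 a b a' b' :
    star_rel (ibrl a (val b) *1 ibrr (val a') b') (LBr (a *1 b) (a' *1 b'))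
| star_11_2 a b a' b' :
    star_rel (LBr (a *1 b) (a' *1 b')) (ibrr (val a) b *2 ibrl a' (val b'))
| star_22_1 a b a' b' :
    star_rel (ibrr (val b) a *1 ibrl b' (val a')) (LBr (b *2 a) (b' *2 a'))
| star_22_2 a b a' b' :
    star_rel (LBr (b *2 a) (b' *2 a')) (ibrl b (val a) *2 ibrr (val b') a')
| star_12_1 a b a' b' :
    star_rel (ibrl a (val b) *1 ibrl b' (val a')) (LBr (a *1 b) (b' *2 a'))
| star_12_2 a b a' b' :
    star_rel (LBr (a *1 b) (b' *2 a')) (ibrr (val a) b *2 ibrr (val b') a')
| star_21_1 a b a' b' :
    star_rel (ibrr (val b) a *1 ibrr (val a') b') (LBr (b *2 a) (a' *1 b'))
| star_21_2 a b a' b' :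
    star_rel (LBr (b *2 a) (a' *1 b')) (ibrl b (val a) *2 ibrl a' (val b')).

(* The non-abelian tensor product. *)
Local Notation star := (lpres star_rel).

Definition star1 (a : subsp A) (b : subsp B) : star := lgen star_rel (Star1 a b).
Definition star2 (b : subsp B) (a : subsp A) : star := lgen star_rel (Star2 b a).

Definition meet1 (c : subsp (meetp A B)) : subsp A :=
  exist _ (val c) (proj1 (andP (valP c))).
Definition meet2 (c : subsp (meetp A B)) : subsp B :=
  exist _ (val c) (proj2 (andP (valP c))).

Definition ext_gen (w : star) :=
  exists c c' : subsp (meetp A B),
    w = star1 (meet1 c) (meet2 c') - star2 (meet2 c) (meet1 c').
Definition ext_rel : {pred star} := span ext_gen.
HB.instance Definition _ := GRing.SubmodClosed.on ext_rel.

Lemma star_br1 a b a' b' :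
  ⁅star1 a b, star1 a' b'⁆ = star1 (ibrl a (val b)) (ibrr (val a') b').
Proof. by rewrite -lpi_br; apply/esym/lpi_eqP/lcong_rel/star_11_1. Qed.
Lemma star_br2 a b a' b' :
  ⁅star2 b a, star2 b' a'⁆ = star1 (ibrr (val b) a) (ibrl b' (val a')).
Proof. by rewrite -lpi_br; apply/esym/lpi_eqP/lcong_rel/star_22_1. Qed.
Lemma star_br12 a b a' b' :
  ⁅star1 a b, star2 b' a'⁆ = star1 (ibrl a (val b)) (ibrl b' (val a')).
Proof. by rewrite -lpi_br; apply/esym/lpi_eqP/lcong_rel/star_12_1. Qed.
Lemma star_br21 a b a' b' :
  ⁅star2 b a, star1 a' b'⁆ = star1 (ibrr (val b) a) (ibrr (val a') b').
Proof. by rewrite -lpi_br; apply/esym/lpi_eqP/lcong_rel/star_21_1. Qed.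

Lemma ext_gen_central w t : ext_gen w -> ⁅w, t⁆ = 0 /\ ⁅t, w⁆ = 0.
Proof.
move=> [c [c' ->]]; set w0 := _ - _; have [s ->] := lpiP t.
elim: s => [[a b|b a]||s [s1 s2] u [u1 u2]|x s [s1 s2]|s [s1 s2] u [u1 u2]].
- rewrite -[lpi _ _]/(star1 a b) lbrBl lbrBr !star_br1 star_br21 star_br12.
  by split; apply/eqP; rewrite subr_eq0; apply/eqP; congr star1; apply/val_inj.
- rewrite -[lpi _ _]/(star2 b a) lbrBl lbrBr !star_br2 star_br21 star_br12.
  by split; apply/eqP; rewrite subr_eq0; apply/eqP; congr star1; apply/val_inj.
- by rewrite lpi0 lbr0r lbr0l.
- by rewrite lpiD lbrDr s1 u1 lbrDl s2 u2 addr0.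
- by rewrite lpiZ lbrZr lbrZl s1 s2 scaler0.
- rewrite lpi_br lbr_leibniz s1 u1 !lbr0l subrr; split=> //.
  have := lbr_leibniz (lpi star_rel s) (lpi star_rel u) w0.
  by rewrite u2 s2 lbr0r lbr0l subr0 => <-.
Qed.

Lemma ext_rel_central w t : w \in ext_rel -> ⁅w, t⁆ = 0 /\ ⁅t, w⁆ = 0.
Proof.
move=> /asboolP[s sP ->]; rewrite big_seq; elim/big_ind: _ => [|x y|p /sP].
- by rewrite lbr0r lbr0l.
- by move=> [x1 x2] [y1 y2]; rewrite lbrDr lbrDl x1 x2 y1 y2 addr0.
- by move=> /(ext_gen_central t)[w1 w2]; rewrite lbrZr lbrZl w1 w2 scaler0.
Qed.

Fact ext_rel_ideall (x y : star) : x \in ext_rel -> ⁅x, y⁆ \in ext_rel.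
Proof. by move=> /(ext_rel_central y)[-> _]; apply: rpred0. Qed.
Fact ext_rel_idealr (x y : star) : y \in ext_rel -> ⁅x, y⁆ \in ext_rel.
Proof. by move=> /(ext_rel_central x)[_ ->]; apply: rpred0. Qed.
HB.instance Definition _ :=
  isLeibnizIdeal.Build K star ext_rel ext_rel_ideall ext_rel_idealr.

(* The non-abelian exterior product. *)
Local Notation ext := (vquot ext_rel).

Definition ext1 a b : ext := vpi ext_rel (star1 a b).
Definition ext2 b a : ext := vpi ext_rel (star2 b a).

Fact meet_br1 (a : subsp A) (b : subsp B) : ⁅val a, val b⁆ \in meetp A B.
Proof.
by rewrite unfold_in /meetp (lbr_ideall _ _ (valP a)) (lbr_idealr _ _ (valP b)).
Qed.
Fact meet_br2 (b : subsp B) (a : subsp A) : ⁅val b, val a⁆ \in meetp A B.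
Proof.
by rewrite unfold_in /meetp (lbr_idealr _ _ (valP a)) (lbr_ideall _ _ (valP b)).
Qed.

Definition theta_gen (x : star_gen) : subsp (meetp A B) :=
  match x with
  | Star1 a b => exist _ ⁅val a, val b⁆ (meet_br1 a b)
  | Star2 b a => exist _ ⁅val b, val a⁆ (meet_br2 b a)
  end.

Fact theta_star s t : star_rel s t -> leval theta_gen s = leval theta_gen t.
Proof.
by case=> *; apply/val_inj; rewrite /= ?scaleN1r;
  rewrite ?(lbrDl, lbrDr, lbrZl, lbrZr) // !lbr_leibniz ?opprB ?subrKC ?subKr.
Qed.

Definition theta_star_hom : {leibniz star -> subsp (meetp A B)} :=
  llift theta_star.

Fact theta_ext w : w \in ext_rel -> theta_star_hom w = 0.
Proof.
move=> wE; apply/eqP; rewrite -[_ == 0]/(w \in lkern theta_star_hom).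
apply: span_sub wE => _ [c [c' ->]].
rewrite unfold_in /lkern linearB subr_eq0 /theta_star_hom /= !llift_gen.
exact/eqP/val_inj.
Qed.

Definition theta : ext -> subsp (meetp A B) := vlift theta_ext.
HB.instance Definition _ := GRing.Linear.on theta.

Lemma theta_ext1 a b : val (theta (ext1 a b)) = ⁅val a, val b⁆.
Proof. by rewrite /theta vlift_pi /= llift_gen. Qed.
Lemma theta_ext2 b a : val (theta (ext2 b a)) = ⁅val b, val a⁆.
Proof. by rewrite /theta vlift_pi /= llift_gen. Qed.

Fact theta_lbr : {morph theta : x y / ⁅x, y⁆ >-> ⁅x, y⁆}.
Proof.
move=> x y; have [[u ->] [v ->]] := conj (vpiP x) (vpiP y).
by rewrite -vpi_lbr /theta !vlift_pi; apply: llift_lbr.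
Qed.
HB.instance Definition _ :=
  isLeibnizHom.Build K ext (subsp (meetp A B)) theta theta_lbr.

End ExteriorProduct.

Notation star A B := (lpres (@star_rel _ _ A B)).
Notation ext A B := (vquot (@ext_rel _ _ A B)).

Section TensorPower.
Variables (K : fieldType) (V : lmodType K) (n : nat).

Definition upd (x : {ffun 'I_n -> V}) (i : 'I_n) (u : V) : {ffun 'I_n -> V} :=
  [ffun k => if k == i then u else x k].

Definition multilinear (W : lmodType K) (f : {ffun 'I_n -> V} -> W) :=
  forall x i c u v,
    f (upd x i (c *: u + v)) = c *: f (upd x i u) + f (upd x i v).

(* [<< x >>] is the basis vector [x] of the free vector space. *)
Definition tpow_gen (w : {freeg {ffun 'I_n -> V} / K}) :=
  exists x i c u v, w = << upd x i (c *: u + v) >>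
                        - (c *: << upd x i u >> + << upd x i v >>).
Definition tpow_rel : {pred {freeg {ffun 'I_n -> V} / K}} := span tpow_gen.
HB.instance Definition _ := GRing.SubmodClosed.on tpow_rel.

Definition tpow := vquot tpow_rel.
HB.instance Definition _ := GRing.Lmodule.on tpow.

Definition tens (x : {ffun 'I_n -> V}) : tpow := vpi tpow_rel << x >>.

Lemma tens_multilinear : multilinear tens.
Proof.
move=> x i c u v; rewrite /tens -linearP; apply/vpi_eqP/mem_span.
by exists x, i, c, u, v.
Qed.

Section Lift.
Variables (W : lmodType K) (f : {ffun 'I_n -> V} -> W).

Fact fglift_is_zmod : zmod_morphism (fglift f).
Proof. exact: lift_is_additive. Qed.
HB.instance Definition _ :=
  GRing.isZmodMorphism.Build {freeg {ffun 'I_n -> V} / K} W (fglift f)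
    fglift_is_zmod.
Fact fglift_is_scalable : scalable (fglift f).
Proof.
move=> c D; rewrite -{2}[D]freeg_sumE [c *: D]/(fgscale c D) /fgscale.
rewrite !raddf_sum /=; apply: eq_bigr => x _.
by rewrite !liftU scalerA.
Qed.
HB.instance Definition _ :=
  GRing.isScalable.Build K {freeg {ffun 'I_n -> V} / K} W *:%R (fglift f)
    fglift_is_scalable.

Hypothesis fM : multilinear f.

Fact tlift_rel w : w \in tpow_rel -> fglift f w = 0.
Proof.
move=> wE; apply/eqP; rewrite -[_ == 0]/(w \in lkern (fglift f)).
apply: span_sub wE => _ [x [i [c [u [v ->]]]]].
by rewrite unfold_in /lkern linearB linearP /= !liftU !scale1r fM subrr.
Qed.

Definition tlift : tpow -> W := vlift tlift_rel.
HB.instance Definition _ := GRing.Linear.on tlift.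

Lemma tliftE x : tlift (tens x) = f x.
Proof. by rewrite /tlift vlift_pi /= liftU scale1r. Qed.

End Lift.
End TensorPower.

Section TensorPowerMap.
Variables (K : fieldType) (V W : lmodType K) (f : {linear V -> W}) (n : nat).

Fact tpow_map_multilinear :
  multilinear (fun x : {ffun 'I_n -> V} => tens [ffun i => f (x i)]).
Proof.
move=> x i c u v; have E w : [ffun k => f (upd x i w k)]
    = upd [ffun k => f (x k)] i (f w) by apply/ffunP=> k; rewrite !ffunE; case: eqP.
by rewrite !E linearP tens_multilinear.
Qed.

Definition tpow_map : tpow V n -> tpow W n := tlift tpow_map_multilinear.
HB.instance Definition _ := GRing.Linear.on tpow_map.

Lemma tpow_mapE x : tpow_map (tens x) = tens [ffun i => f (x i)].
Proof. exact: tliftE. Qed.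

End TensorPowerMap.

Arguments tpow_map {K V W} f {n}.

Section LinearSpan.
Variables (K : fieldType) (V W : lmodType K) (n : nat).

Lemma tpow_eq (f f' : {linear tpow V n -> W}) :
  (forall x, f (tens x) = f' (tens x)) -> f =1 f'.
Proof.
move=> ff' t; have [w ->] := vpiP t; rewrite -[w]freeg_sumE !raddf_sum /=.
apply: eq_bigr => x _.
have -> : << coeff x w *g x >> = coeff x w *: << x >> :> {freeg _ / K}.
  by apply/eqP/freeg_eqP => y; rewrite coeffZ !coeffU mul1r.
by rewrite !linearZ /= -/(tens x) ff'.
Qed.

End LinearSpan.

Section LeibnizHomology.
Variables (K : fieldType) (g : leibnizType K) (n : nat).

(* Indices start at 0: x_j is deleted and, for i < j, x_i is replaced by
   [x_i, x_j]. *)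
Definition lface (x : {ffun 'I_n -> g}) (i j : 'I_n) : {ffun 'I_n.-1 -> g} :=
  [ffun k => if fintype.lift j k == i then ⁅x i, x j⁆ else x (fintype.lift j k)].

Definition ldiff_tens (x : {ffun 'I_n -> g}) : tpow g n.-1 :=
  \sum_(j < n) \sum_(i < n | (i < j)%N) (-1) ^+ j.+1 *: tens (lface x i j).

Fact lface_multilinear i j : i != j -> multilinear (fun x => tens (lface x i j)).
Proof.
move=> ij x m c u v; case: (unliftP j i) => [k0 ik0|ji]; last by rewrite ji eqxx in ij.
have [mj|mj] := eqVneq m j.
  have E w : lface (upd x m w) i j = upd (lface x i j) k0 ⁅x i, w⁆.
    apply/ffunP=> k; rewrite !ffunE mj (negbTE ij) eqxx [_ == j]eq_sym (negbTE (neq_lift j k)).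
    by rewrite ik0 (inj_eq (@lift_inj _ j)); case: (k == k0).
  by rewrite !E lbr_linearr tens_multilinear.
have [mi|mi] := eqVneq m i.
  have E w : lface (upd x m w) i j = upd (lface x i j) k0 ⁅w, x j⁆.
    apply/ffunP=> k; rewrite !ffunE mi eqxx [j == i]eq_sym (negbTE ij).
    by rewrite {1 2 3}ik0 (inj_eq (@lift_inj _ j)); case: (k == k0).
  by rewrite !E lbr_linearl tens_multilinear.
case: (unliftP j m) => [km mkm|mj']; last by rewrite mj' eqxx in mj.
have E w : lface (upd x m w) i j = upd (lface x i j) km w.
  apply/ffunP=> k; rewrite !ffunE ![_ == m]eq_sym (negbTE mj) (negbTE mi).
  rewrite [m == _]eq_sym mkm (inj_eq (@lift_inj _ j)).
  by case: (k =P km) => // ->; rewrite -mkm (negbTE mi).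
by rewrite !E tens_multilinear.
Qed.

Fact ldiff_multilinear : multilinear ldiff_tens.
Proof.
move=> x m c u v; rewrite /ldiff_tens scaler_sumr -big_split; apply: eq_bigr => j _.
rewrite scaler_sumr -big_split; apply: eq_bigr => i ij /=.
rewrite lface_multilinear ?scalerDr ?scalerA 1?mulrC //.
by apply: contraTneq ij => ->; rewrite ltnn.
Qed.

(* The differential CL_n -> CL_(n-1); it is 0 for n <= 1 (empty sums). *)
Definition ldiff : tpow g n -> tpow g n.-1 := tlift ldiff_multilinear.
HB.instance Definition _ := GRing.Linear.on ldiff.

Lemma ldiffE x : ldiff (tens x) = ldiff_tens x.
Proof. exact: tliftE. Qed.

End LeibnizHomology.

Arguments ldiff {K} g n.

Section Homology.
Variables (K : fieldType) (n : nat) (g : leibnizType K).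

Definition cycles := ker (ldiff g n).
HB.instance Definition _ := GRing.Lmodule.on cycles.

Definition boundaries : {pred tpow g n} := limage (ldiff g n.+1).
HB.instance Definition _ := GRing.SubmodClosed.on boundaries.

(* The boundaries as a subspace of the cycles: the quotient below is formed
   without appealing to the identity d d = 0. *)
Definition cycle_boundaries : {pred cycles} :=
  lpreim (\val : cycles -> tpow g n) boundaries.
HB.instance Definition _ := GRing.SubmodClosed.on cycle_boundaries.

Definition HL := vquot cycle_boundaries.
HB.instance Definition _ := GRing.Lmodule.on HL.

Definition cycle_class (z : cycles) : HL := vpi cycle_boundaries z.
Fact cycle_class_is_linear : linear cycle_class.
Proof. exact: vpi_is_linear. Qed.
HB.instance Definition _ :=
  GRing.isLinear.Build K cycles HL *:%R cycle_class cycle_class_is_linear.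
End Homology.

Arguments cycle_class {K n g} z.

Arguments boundaries {K} n g.
Arguments cycle_boundaries {K} n g.


Section HomologyMap.
Variables (K : fieldType) (n : nat) (g h : leibnizType K) (f : {leibniz g -> h}).

Fact tpow_map_ldiff m (t : tpow g m) :
  ldiff h m (tpow_map f t) = tpow_map f (ldiff g m t).
Proof.
suff /(_ t) : ldiff h m \o tpow_map f =1 tpow_map f \o ldiff g m by [].
apply: (@tpow_eq K g _ m (ldiff h m \o tpow_map f : {linear _ -> _})
  (tpow_map f \o ldiff g m : {linear _ -> _})) => x.
rewrite /= tpow_mapE !ldiffE /ldiff_tens linear_sum; apply: eq_bigr => j _.
rewrite linear_sum; apply: eq_bigr => i _; rewrite linearZ /= tpow_mapE.
congr (_ *: tens _); apply/ffunP=> k; rewrite !ffunE.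
by case: eqP => // _; apply/esym/(lbr_morph (s := f)).
Qed.

Fact cycle_map_subproof (z : cycles n g) :
  tpow_map f (val z) \in lkern (ldiff h n).
Proof.
apply/eqP; apply: etrans (tpow_map_ldiff _) _.
exact: etrans (congr1 _ (eqP (valP z))) (linear0 _).
Qed.
Definition cycle_map (z : cycles n g) : cycles n h :=
  exist _ (tpow_map f (val z)) (cycle_map_subproof z).
Fact cycle_map_is_linear : linear cycle_map.
Proof. by move=> c x y; apply/val_inj; rewrite /= linearP. Qed.
HB.instance Definition _ := GRing.isLinear.Build K (cycles n g) (cycles n h)
  *:%R cycle_map cycle_map_is_linear.

Fact HL_map_subproof z :
  z \in cycle_boundaries n g -> (cycle_class \o cycle_map) z = 0.
Proof.
move=> /asboolP[w wz]; apply/eqP; rewrite /= /cycle_class vpi_eq0.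
apply/asboolP; exists (tpow_map f w).
exact: etrans (tpow_map_ldiff _) (congr1 _ wz).
Qed.
Definition HL_map : HL n g -> HL n h := vlift HL_map_subproof.
HB.instance Definition _ := GRing.Linear.on HL_map.

End HomologyMap.

Arguments HL_map {K} n {g h} f.
Arguments theta {K g} A B.

Definition exact_at (T U : Type) (W : zmodType) (f : T -> U) (k : U -> W) :=
  forall y, k y = 0 <-> exists x, f x = y.

Record short_exact (K : fieldType) (a g h : leibnizType K)
    (i : {leibniz a -> g}) (tau : {leibniz g -> h}) : Prop := ShortExact {
  se_inj : injective i;
  se_exact : exact_at i tau;
  se_surj : forall y, exists x, tau x = y
}.

Section Extension.
Variables (K : fieldType) (a g h : leibnizType K).
Variables (i : {leibniz a -> g}) (tau : {leibniz g -> h}).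

(* The ideal of g with which a is identified. *)
Definition extp of short_exact i tau : {pred g} := limage i.

Variable E : short_exact i tau.
HB.instance Definition _ := GRing.SubmodClosed.on (extp E).
Lemma extpE x : (x \in extp E) = (tau x == 0).
Proof. by apply/asboolP/eqP => /(se_exact E). Qed.
Fact extp_ideall (x y : g) : x \in extp E -> ⁅x, y⁆ \in extp E.
Proof. by rewrite !extpE lbr_morph => /eqP->; rewrite lbr0l. Qed.
Fact extp_idealr (x y : g) : y \in extp E -> ⁅x, y⁆ \in extp E.
Proof. by rewrite !extpE lbr_morph => /eqP->; rewrite lbr0r. Qed.
HB.instance Definition _ :=
  isLeibnizIdeal.Build K g (extp E) extp_ideall extp_idealr.
End Extension.

Section Abelianization.
Variables (K : fieldType) (g : leibnizType K) (A B : leibnizIdeal g).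

Definition commp_in : {pred subsp A} := lpreim (\val : subsp A -> g) (commp A B).
HB.instance Definition _ := GRing.SubmodClosed.on commp_in.

(* The quotient A / [A, B]; [commp_in] is [A, B] as a subspace of A. *)
Definition commquo := vquot commp_in.
HB.instance Definition _ := GRing.Lmodule.on commquo.
End Abelianization.

(* Main.v *)
Require Import Defs.
From HB Require Import structures.
From mathcomp Require Import all_boot all_algebra.
From mathcomp Require Import boolp classical_sets.

(* The kernel N of CL(g) -> CL(h) is, in degree n, the span of the tensors with
   an entry in the ideal a, and the sequence is the long exact homology sequence
   of 0 -> N -> CL(g) -> CL(h) -> 0 in low degrees: H_1(N) = a / [a, g], and
   H_2(N) = Ker theta because N_2 / d N_3 is the exterior product a ⋏ g.
   A linear section s of tau (this is where K being a field is used) makes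
   everything explicit: with p = 1 - s tau, the map
   x ⊗ y |-> p x ⋏ y + (x - p x) ⋏ p y is defined on all of g ⊗ g and inverts
   a ⋏ g -> N_2 / d N_3 on N_2, and the connecting maps send the class of a cycle
   z to d (s z). *)

Set Implicit Arguments.
Unset Strict Implicit.
Unset Printing Implicit Defensive.
Import GRing.Theory.
Local Open Scope ring_scope.

(** * Linear sections *)

Section LinearSection.
Variables (K : fieldType) (V W : lmodType K) (f : {linear V -> W}).

(* Closure is asked only of inhabited sets, so that the union of the empty chain
   qualifies in Zorn's lemma. *)
Let meets_ker_trivially (S : set V) :=
  (forall c u v, S u -> S v -> S (c *: u + v)) /\
  (forall u, S u -> f u = 0 -> u = 0).

(** Zorn: if S is maximal among the subspaces meeting the kernel trivially and f v were missed by f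
    on S, adding the line of v to S would give a larger one. *)
Lemma exists_ker_complement : exists S : set V,
  meets_ker_trivially S /\ forall v, exists2 u, S u & f u = f v.
Proof.
have [F FP Ftot|S [[SL S0] Smax]] := @Zorn_bigcup V meets_ker_trivially.
  split=> [c u v [X FX Xu] [Y FY Yv]|u [X /FP[_ X0] Xu]]; last exact: X0.
  have [XY|YX] := Ftot X Y FX FY.
    by exists Y => //; apply: (proj1 (FP _ FY)) => //; apply: XY.
  by exists X => //; apply: (proj1 (FP _ FX)) => //; apply: YX.
exists S; split=> // v; apply: contrapT => noS.
(* The case [u = 0] is listed apart because S, possibly empty, need not contain 0. *)
pose S' := [set w | S w \/ exists c u, (S u \/ u = 0) /\ w = c *: v + u]%classic.
have SS' u u' c : S u \/ u = 0 -> S u' \/ u' = 0 -> S (c *: u + u') \/ c *: u + u' = 0.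
  move=> [Su|->] [Su'|->]; rewrite ?scaler0 ?addr0 ?add0r; try by [left|right].
    by left; apply: SL.
  have SZ : S 0 by have := SL (-1) u u Su Su; rewrite scaleN1r addNr.
  by left; have := SL c u 0 Su SZ; rewrite addr0.
have repS w : S' w -> exists c u, (S u \/ u = 0) /\ w = c *: v + u.
  by case=> // Sw; exists 0, w; split; [left|rewrite scale0r add0r].
apply: (Smax S').
  split=> [w Sw|]; first by left.
  move=> /(_ v); have S'v : S' v.
    by right; exists 1, 0; split; [right|rewrite scale1r addr0].
  by move=> /(_ S'v) Sv; apply: noS; exists v.
split.
  move=> c w w' /repS[d [u [Su ->]]] /repS[d' [u' [Su' ->]]]; right.
  exists (c * d + d'), (c *: u + u'); split; first exact: SS'.
  by rewrite scalerDr addrACA scalerA -scalerDl.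
move=> w /repS[c [u [Su ->]]].
have [->|c0] := eqVneq c 0.
  by rewrite scale0r add0r => fu; case: Su => // Su; apply: S0.
rewrite linearD linearZ /= => fw; exfalso.
have fv : f (- c^-1 *: u + 0) = f v.
  have fu : f u = - (c *: f v) by apply/eqP; rewrite -addr_eq0 addrC fw.
  by rewrite addr0 linearZ /= fu scaleNr scalerN opprK scalerA mulVf // scale1r.
have [Su0|u0] := SS' u 0 (- c^-1) Su (or_intror erefl).
  by apply: noS; exists (- c^-1 *: u + 0).
(* Now f v = 0, so 0 would be a preimage in S if S were inhabited; and if S is empty, the set of 0
   alone is strictly larger. *)
case: (pselect (exists x, S x)) => [[x Sx]|noS0].
  apply: noS; exists 0; first by have := SL (-1) x x Sx Sx; rewrite scaleN1r addNr.
  by rewrite -u0.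
have SZ : meets_ker_trivially [set 0]%classic.
  by split=> [d x y -> ->|//]; rewrite /= scaler0 addr0.
apply: (Smax [set 0]%classic) SZ; split=> [x Sx|/(_ 0 erefl) SZ0].
  by case: noS0; exists x.
by case: noS0; exists 0.
Qed.

(** Preimages chosen in a complement of the kernel are unique, so the choice function is
    automatically linear. *)
Lemma linear_section : (forall y, exists x, f x = y) ->
  exists s : {linear W -> V}, forall y, f (s y) = y.
Proof.
move=> fsurj; have [S [[SL S0] Ssurj]] := exists_ker_complement.
have sP y : exists x, S x /\ f x = y.
  by have [v <-] := fsurj y; have [u Su fu] := Ssurj v; exists u.
have [s sE] := choice sP.
have s_lin : linear s.
  move=> c x y; apply/eqP; rewrite -subr_eq0; apply/eqP/S0; last first.
    by rewrite linearB linearP /= !(proj2 (sE _)) subrr.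
  rewrite [_ - _]addrC -scaleN1r.
  by apply: (SL (-1)); [apply: SL|]; apply: (proj1 (sE _)).
pose sl := HB.pack_for {linear W -> V} s (GRing.isLinear.Build K W V *:%R s s_lin).
by exists sl => y; apply: (proj2 (sE y)).
Qed.

End LinearSection.

(** * Small tensors and differentials *)

Section LinearMapExtras.
Variables (K : fieldType) (V W : lmodType K).

(** Unlike [span_sub], this serves for properties not packaged as a [submodClosed] predicate, such
    as the existence of a preimage. *)
Lemma span_ind (P Q : V -> Prop) :
  Q 0 -> (forall c u v, Q u -> Q v -> Q (c *: u + v)) ->
  (forall v, P v -> Q v) -> forall v, v \in Defs.span P -> Q v.
Proof.
move=> Q0 QD PQ v /asboolP[s sP ->].
elim: s sP => [|q s IHs] sP; first by rewrite big_nil.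
rewrite big_cons; apply: QD; first by apply/PQ/sP; rewrite mem_head.
by apply: IHs => r rs; apply: sP; rewrite in_cons rs orbT.
Qed.

Lemma linear_comp_fun (U : lmodType K) (f : V -> W) (e : U -> V) :
  linear f -> linear e -> linear (fun u => f (e u)).
Proof. by move=> fL eL c u v; rewrite eL fL. Qed.

Lemma tpow_linear_eq n (f f' : tpow V n -> W) : linear f -> linear f' ->
  (forall x, f (tens x) = f' (tens x)) -> f =1 f'.
Proof.
move=> fL fL'.
pose F := HB.pack_for {linear tpow V n -> W} f (GRing.isLinear.Build K _ _ *:%R f fL).
pose F' :=
  HB.pack_for {linear tpow V n -> W} f' (GRing.isLinear.Build K _ _ *:%R f' fL').
exact: (@tpow_eq K V W n F F').
Qed.

End LinearMapExtras.

(** Membership in S is vanishing in the quotient by S, hence an equality of linear maps, which pure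
    tensors decide. *)
Lemma tpow_mem (K : fieldType) (V W : lmodType K) n (f : tpow V n -> W)
    (S : submodClosed W) :
  linear f -> (forall x, f (tens x) \in S) -> forall t, f t \in S.
Proof.
move=> fL fS t; rewrite -vpi_eq0; apply/eqP.
apply: (tpow_linear_eq (f := fun u => vpi S (f u)) (f' := fun=> 0)) => [||x].
- by apply: linear_comp_fun fL; apply: linearP.
- by move=> c u v; rewrite scaler0 addr0.
by apply/eqP; rewrite vpi_eq0.
Qed.

Section SmallTensors.
Variables (K : fieldType) (V : lmodType K).
Implicit Types x y z w : V.

(** Reading the entries from a list turns [upd] into [set_nth], which computes on explicit lists. *)
Definition fseq n (s : seq V) : {ffun 'I_n -> V} := [ffun k : 'I_n => nth 0 s k].
Arguments fseq n s : clear implicits.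

Lemma fseq_upd n s i u : upd (fseq n s) i u = fseq n (set_nth 0 s i u).
Proof. by apply/ffunP=> k; rewrite !ffunE nth_set_nth. Qed.

Lemma fseq_mkseq n (x : {ffun 'I_n.+1 -> V}) :
  x = fseq n.+1 (mkseq (fun k => x (inord k)) n.+1).
Proof. by apply/ffunP=> k; rewrite ffunE nth_mkseq // inord_val. Qed.

Definition tens1 x : tpow V 1 := tens (fseq 1 [:: x]).
Definition tens2 x y : tpow V 2 := tens (fseq 2 [:: x; y]).
Definition tens3 x y z : tpow V 3 := tens (fseq 3 [:: x; y; z]).
Definition tens4 w x y z : tpow V 4 := tens (fseq 4 [:: w; x; y; z]).

(** Entry i of [s] is overwritten, so the 0 put there in the instances below is a placeholder. *)
Lemma tens_fseq_linear n s (i : 'I_n) :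
  linear (fun u => tens (fseq n (set_nth 0 s i u))).
Proof. by move=> c u v; rewrite -!fseq_upd tens_multilinear. Qed.

Lemma tens1_is_linear : linear tens1.
Proof. exact: (@tens_fseq_linear 1 [:: 0] ord0). Qed.
Lemma tens2_is_linearl y : linear (tens2^~ y).
Proof. exact: (@tens_fseq_linear 2 [:: 0; y] ord0). Qed.
Lemma tens2_is_linearr x : linear (tens2 x).
Proof. exact: (@tens_fseq_linear 2 [:: x; 0] (@Ordinal 2 1 isT)). Qed.
Lemma tens3_is_linear1 y z : linear (fun x => tens3 x y z).
Proof. exact: (@tens_fseq_linear 3 [:: 0; y; z] ord0). Qed.
Lemma tens3_is_linear2 x z : linear (fun y => tens3 x y z).
Proof. exact: (@tens_fseq_linear 3 [:: x; 0; z] (@Ordinal 3 1 isT)). Qed.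
Lemma tens3_is_linear3 x y : linear (tens3 x y).
Proof. exact: (@tens_fseq_linear 3 [:: x; y; 0] (@Ordinal 3 2 isT)). Qed.

HB.instance Definition _ := GRing.isLinear.Build K V _ *:%R tens1 tens1_is_linear.
HB.instance Definition _ x :=
  GRing.isLinear.Build K V _ *:%R (tens2 x) (tens2_is_linearr x).
HB.instance Definition _ x y :=
  GRing.isLinear.Build K V _ *:%R (tens3 x y) (tens3_is_linear3 x y).

Lemma tens1B x x' : tens1 (x - x') = tens1 x - tens1 x'.
Proof. exact: linearB. Qed.
Lemma tens2Bl x x' y : tens2 (x - x') y = tens2 x y - tens2 x' y.
Proof. exact: (zmod_morphism_linear (tens2_is_linearl y)). Qed.
Lemma tens2Br x y y' : tens2 x (y - y') = tens2 x y - tens2 x y'.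
Proof. exact: linearB. Qed.
Lemma tens2_0l y : tens2 0 y = 0.
Proof. by rewrite -(subrr 0) tens2Bl subrr. Qed.
Lemma tens2_0r x : tens2 x 0 = 0.
Proof. exact: linear0. Qed.
Lemma tens3Bl x x' y z : tens3 (x - x') y z = tens3 x y z - tens3 x' y z.
Proof. exact: (zmod_morphism_linear (tens3_is_linear1 y z)). Qed.
Lemma tens3Bm x y y' z : tens3 x (y - y') z = tens3 x y z - tens3 x y' z.
Proof. exact: (zmod_morphism_linear (tens3_is_linear2 x z)). Qed.
Lemma tens3Br x y z z' : tens3 x y (z - z') = tens3 x y z - tens3 x y z'.
Proof. exact: linearB. Qed.
Lemma tens3_0l y z : tens3 0 y z = 0.
Proof. by rewrite -(subrr 0) tens3Bl subrr. Qed.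
Lemma tens3_0m x z : tens3 x 0 z = 0.
Proof. by rewrite -(subrr 0) tens3Bm subrr. Qed.
Lemma tens3_0r x y : tens3 x y 0 = 0.
Proof. exact: linear0. Qed.

Variable W : lmodType K.

Lemma tpow1_eq (f f' : tpow V 1 -> W) : linear f -> linear f' ->
  (forall x, f (tens1 x) = f' (tens1 x)) -> f =1 f'.
Proof.
move=> fL fL' ff'; apply: tpow_linear_eq => // x.
by rewrite (fseq_mkseq x); apply: ff'.
Qed.
Lemma tpow2_eq (f f' : tpow V 2 -> W) : linear f -> linear f' ->
  (forall x y, f (tens2 x y) = f' (tens2 x y)) -> f =1 f'.
Proof.
move=> fL fL' ff'; apply: tpow_linear_eq => // x.
by rewrite (fseq_mkseq x); apply: ff'.
Qed.
Lemma tpow4_eq (f f' : tpow V 4 -> W) : linear f -> linear f' ->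
  (forall w x y z, f (tens4 w x y z) = f' (tens4 w x y z)) -> f =1 f'.
Proof.
move=> fL fL' ff'; apply: tpow_linear_eq => // x.
by rewrite (fseq_mkseq x); apply: ff'.
Qed.

Lemma tpow2_mem (f : tpow V 2 -> W) (S : submodClosed W) : linear f ->
  (forall x y, f (tens2 x y) \in S) -> forall t, f t \in S.
Proof. by move=> fL fS; apply: tpow_mem => // x; rewrite (fseq_mkseq x); apply: fS. Qed.
Lemma tpow3_mem (f : tpow V 3 -> W) (S : submodClosed W) : linear f ->
  (forall x y z, f (tens3 x y z) \in S) -> forall t, f t \in S.
Proof. by move=> fL fS; apply: tpow_mem => // x; rewrite (fseq_mkseq x); apply: fS. Qed.

Section Lift2.
Variable f : V -> V -> W.
Hypotheses (fl : forall y, linear (f^~ y)) (fr : forall x, linear (f x)).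

Lemma bilinear_multilinear :
  multilinear (fun x : {ffun 'I_2 -> V} => f (x ord0) (x ord_max)).
Proof.
move=> x i c u v; rewrite !ffunE; have [<-|i0] := eqVneq ord0 i.
  by rewrite /= fl.
suff -> : i = ord_max by rewrite eqxx fr.
by case: i i0 => -[|[|]] // ? _; apply/val_inj.
Qed.

Definition tlift2 : tpow V 2 -> W := tlift bilinear_multilinear.
HB.instance Definition _ := GRing.Linear.on tlift2.

Lemma tlift2E x y : tlift2 (tens2 x y) = f x y.
Proof. by rewrite /tlift2 tliftE !ffunE. Qed.
End Lift2.

Lemma id_multilinear : multilinear (fun x : {ffun 'I_1 -> V} => x ord0).
Proof. by move=> x i c u v; rewrite !ffunE [i]ord1. Qed.

Definition untens1 : tpow V 1 -> V := tlift id_multilinear.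
HB.instance Definition _ := GRing.Linear.on untens1.

Lemma tens1K : cancel tens1 untens1.
Proof. by move=> x; rewrite /untens1 tliftE ffunE. Qed.

End SmallTensors.

Lemma untens1K (K : fieldType) (V : lmodType K) : cancel (@untens1 K V) (@tens1 K V).
Proof.
apply: (tpow1_eq (f := fun t => tens1 (untens1 t)) (f' := id)) => [||x] //.
  by apply: linear_comp_fun; apply: linearP.
by rewrite tens1K.
Qed.

Section SmallTensorMaps.
Variables (K : fieldType) (V W : lmodType K) (f : {linear V -> W}).

Lemma tpow_map_fseq n s : size s = n ->
  tpow_map f (tens (fseq n s)) = tens (fseq n (map f s)).
Proof.
move=> sn; rewrite tpow_mapE; congr tens; apply/ffunP => k.
by rewrite !ffunE (nth_map 0) // sn.
Qed.

Lemma tpow_mapB n (t u : tpow V n) : tpow_map f (t - u) = tpow_map f t - tpow_map f u.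
Proof. exact: linearB. Qed.
Lemma tpow_map1E x : tpow_map f (tens1 x) = tens1 (f x).
Proof. exact: tpow_map_fseq. Qed.
Lemma tpow_map2E x y : tpow_map f (tens2 x y) = tens2 (f x) (f y).
Proof. exact: tpow_map_fseq. Qed.
Lemma tpow_map3E x y z : tpow_map f (tens3 x y z) = tens3 (f x) (f y) (f z).
Proof. exact: tpow_map_fseq. Qed.

Lemma tpow_map_cancel (s : {linear W -> V}) n :
  cancel s f -> cancel (@tpow_map _ _ _ s n) (tpow_map f).
Proof.
move=> sK.
apply: (tpow_linear_eq (f := fun t => tpow_map f (tpow_map s t)) (f' := id))
  => [||x] //.
  by apply: linear_comp_fun; apply: linearP.
by rewrite !tpow_mapE; congr tens; apply/ffunP=> k; rewrite !ffunE sK.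
Qed.
End SmallTensorMaps.

Section SmallDifferentials.
Variables (K : fieldType) (g : leibnizType K).
Implicit Types w x y z : g.

Lemma ldiff1_eq0 (t : tpow g 1) : ldiff g 1 t = 0.
Proof.
apply: (tpow_linear_eq (f' := fun=> 0)) => [||x]; first exact: linearP.
  by move=> c u v; rewrite scaler0 addr0.
by rewrite ldiffE /ldiff_tens big_ord1 big_pred0.
Qed.

(* The differentials at the types [tpow g 2], ..., to which [tpow g 3.-1],
   ..., are only convertible. *)
Definition diff2 : tpow g 2 -> tpow g 1 := ldiff g 2.
Definition diff3 : tpow g 3 -> tpow g 2 := ldiff g 3.
Definition diff4 : tpow g 4 -> tpow g 3 := ldiff g 4.
Lemma diff2_is_linear : linear diff2. Proof. exact: linearP. Qed.
Lemma diff3_is_linear : linear diff3. Proof. exact: linearP. Qed.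
Lemma diff4_is_linear : linear diff4. Proof. exact: linearP. Qed.
HB.instance Definition _ := GRing.isLinear.Build K _ _ *:%R diff2 diff2_is_linear.
HB.instance Definition _ := GRing.isLinear.Build K _ _ *:%R diff3 diff3_is_linear.
HB.instance Definition _ := GRing.isLinear.Build K _ _ *:%R diff4 diff4_is_linear.

Lemma diff2B t u : diff2 (t - u) = diff2 t - diff2 u. Proof. exact: linearB. Qed.
Lemma diff2N t : diff2 (- t) = - diff2 t. Proof. exact: linearN. Qed.
Lemma diff3B t u : diff3 (t - u) = diff3 t - diff3 u. Proof. exact: linearB. Qed.
Lemma diff3D t u : diff3 (t + u) = diff3 t + diff3 u. Proof. exact: linearD. Qed.
Lemma diff3N t : diff3 (- t) = - diff3 t. Proof. exact: linearN. Qed.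

Lemma diff2E x y : diff2 (tens2 x y) = tens1 ⁅x, y⁆.
Proof.
rewrite /diff2 /tens1 /tens2 ldiffE /ldiff_tens.
under eq_bigr do rewrite big_mkcond.
rewrite !(big_ord_recl, big_ord0) /=.
rewrite !(addr0, add0r) !exprS expr0 !(mulr1, mulN1r, opprK) scale1r.
by congr tens; apply/ffunP=> -[[|//] ?]; rewrite !ffunE.
Qed.

Lemma diff3E x y z : diff3 (tens3 x y z) =
  tens2 ⁅x, y⁆ z - tens2 ⁅x, z⁆ y - tens2 x ⁅y, z⁆.
Proof.
rewrite /diff3 /tens2 /tens3 ldiffE /ldiff_tens.
under eq_bigr do rewrite big_mkcond.
rewrite !(big_ord_recl, big_ord0) /=.
rewrite !(addr0, add0r) !exprS expr0 !(mulr1, mulN1r, opprK) !(scale1r, scaleN1r) addrA.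
by congr (_ - _ - _); congr tens; apply/ffunP=> -[[|[|//]] ?];
  rewrite !ffunE.
Qed.

Lemma diff4E w x y z : diff4 (tens4 w x y z) =
  tens3 ⁅w, x⁆ y z - tens3 ⁅w, y⁆ x z - tens3 w ⁅x, y⁆ z
  + tens3 ⁅w, z⁆ x y + tens3 w ⁅x, z⁆ y + tens3 w x ⁅y, z⁆.
Proof.
rewrite /diff4 /tens3 /tens4 ldiffE /ldiff_tens.
under eq_bigr do rewrite big_mkcond.
rewrite !(big_ord_recl, big_ord0) /=.
rewrite !(addr0, add0r) !exprS expr0 !(mulr1, mulN1r, opprK).
rewrite !(scale1r, scaleN1r) !addrA.
by congr (_ - _ - _ + _ + _ + _); congr tens; apply/ffunP=> -[[|[|[|//]]] ?];
  rewrite !ffunE.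
Qed.

End SmallDifferentials.

Arguments diff2 {K g}.
Arguments diff3 {K g}.
Arguments diff4 {K g}.

Section SmallDifferentialMaps.
Variables (K : fieldType) (g h : leibnizType K) (f : {leibniz g -> h}).

Lemma tpow_map_diff2 t : tpow_map f (diff2 t) = diff2 (tpow_map f t).
Proof. exact/esym/(@tpow_map_ldiff _ _ _ f 2). Qed.
Lemma tpow_map_diff3 t : tpow_map f (diff3 t) = diff3 (tpow_map f t).
Proof. exact/esym/(@tpow_map_ldiff _ _ _ f 3). Qed.
Lemma tpow_map_diff4 t : tpow_map f (diff4 t) = diff4 (tpow_map f t).
Proof. exact/esym/(@tpow_map_ldiff _ _ _ f 4). Qed.
End SmallDifferentialMaps.

Section DifferentialSquare.
Variables (K : fieldType) (g : leibnizType K).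

(** On x ⊗ y ⊗ z this is the Leibniz identity. *)
Lemma diff2_diff3 (t : tpow g 3) : diff2 (diff3 t) = 0.
Proof.
(* The kernel of the identity is the zero subspace, to which [tpow3_mem] applies. *)
apply/eqP; rewrite -[_ == 0]/(diff2 (diff3 t) \in lkern idfun).
apply: (tpow3_mem (f := fun u => diff2 (diff3 u))) => [|x y z].
  by apply: linear_comp_fun; apply: linearP.
rewrite unfold_in /lkern /= diff3E !diff2B !diff2E -!tens1B.
by rewrite lbr_leibniz subrr linear0.
Qed.

(** Once the brackets nested on the right are expanded by the Leibniz identity, the 22 terms cancel
    in pairs. *)
Lemma diff3_diff4 (t : tpow g 4) : diff3 (diff4 t) = 0.
Proof.
apply: (tpow4_eq (f := fun u => diff3 (diff4 u)) (f' := fun=> 0)) => [||w x y z].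
- by apply: linear_comp_fun; apply: linearP.
- by move=> c u v; rewrite scaler0 addr0.
rewrite diff4E !(diff3D, diff3N) !diff3E.
rewrite !lbr_leibniz !(tens2Bl, tens2Br) !(opprD, opprK) !addrA.
(* Each term is brought next to its opposite. *)
rewrite (ACl ((1*7)*(2*14)*(3*18)*(4*8)*(5*19)*(6*16)*(9*13)
  *(10*21)*(11*15)*(12*20)*(17*22))).
by rewrite /= !(subrr, addNr, addr0).
Qed.

(** The bracket as a linear map on g ⊗ g; its kernel is the space of 2-cycles. *)
Definition tbr (t : tpow g 2) : g := untens1 (diff2 t).
Lemma tbr_is_linear : linear tbr.
Proof. by move=> c u v; rewrite /tbr !linearP. Qed.
HB.instance Definition _ := GRing.isLinear.Build K _ _ *:%R tbr tbr_is_linear.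

Lemma tbrB t u : tbr (t - u) = tbr t - tbr u. Proof. exact: linearB. Qed.
Lemma tbrE x y : tbr (tens2 x y) = ⁅x, y⁆.
Proof. by rewrite /tbr diff2E tens1K. Qed.
Lemma diff2_tbr t : diff2 t = tens1 (tbr t).
Proof. by rewrite /tbr untens1K. Qed.
Lemma tbr_diff3 t : tbr (diff3 t) = 0.
Proof. by rewrite /tbr diff2_diff3 linear0. Qed.

End DifferentialSquare.

Arguments tbr {K g}.

(** * The exterior product as a quotient of 2-chains *)

Section Retract.
Variables (K : fieldType) (g : leibnizType K) (A : leibnizIdeal g).
Variable p : {linear g -> g}.
Hypotheses (pA : forall x, p x \in A) (pK : forall x, x \in A -> p x = x).

(** These span d N_3, since N_3 is generated by the tensors with an entry in A. *)
Definition ideal_bound_gen (t : tpow g 2) := exists x y z,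
  [\/ x \in A, y \in A | z \in A] /\ t = diff3 (tens3 x y z).
Definition ideal_bound : {pred tpow g 2} := Defs.span ideal_bound_gen.
HB.instance Definition _ := GRing.SubmodClosed.on ideal_bound.

Lemma ideal_bound_tbr t : t \in ideal_bound -> tbr t = 0.
Proof.
by move: t; apply: span_ind => [|c u v u0 v0|_ [x [y [z [_ ->]]]]];
  rewrite ?linear0 ?tbr_diff3 // linearP /= u0 v0 scaler0 addr0.
Qed.

Lemma ideal_bound_diff x y z : [\/ x \in A, y \in A | z \in A] ->
  diff3 (tens3 x y z) \in ideal_bound.
Proof. by move=> xyz; apply: mem_span; exists x, y, z. Qed.

(* N_2 / d N_3, enlarged to a quotient of all of g ⊗ g. Its bracket
   [u, v] = p [u] ⊗ p [v] involves the retraction p, which is therefore a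
   parameter of the type; on N_2 it is the bracket of the exterior product. *)
Definition extm of {linear g -> g} := vquot ideal_bound.
HB.instance Definition _ q := GRing.Lmodule.on (extm q).

Definition extm_pi : tpow g 2 -> extm p := vpi ideal_bound.
HB.instance Definition _ := GRing.Linear.on extm_pi.
Lemma extm_pi_eqP t u : reflect (extm_pi t = extm_pi u) (t - u \in ideal_bound).
Proof. exact: vpi_eqP. Qed.

Definition extm_tbr : extm p -> g := vlift ideal_bound_tbr.
HB.instance Definition _ := GRing.Linear.on extm_tbr.
Lemma extm_tbrE t : extm_tbr (extm_pi t) = tbr t.
Proof. exact: vlift_pi. Qed.

Definition extm_br (u v : extm p) : extm p :=
  extm_pi (tens2 (p (extm_tbr u)) (p (extm_tbr v))).

Lemma extm_linearl v : linear (extm_br^~ v).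
Proof. by move=> c u u'; rewrite /extm_br !linearP /= tens2_is_linearl linearP. Qed.
Lemma extm_linearr u : linear (extm_br u).
Proof. by move=> c v v'; rewrite /extm_br !linearP. Qed.
(** Since p fixes brackets of elements of A, the two sides differ by the differential of a tensor of
    three elements of A, namely p applied to the brackets of u, v and w. *)
Lemma extm_leibniz u v w :
  extm_br u (extm_br v w) = extm_br (extm_br u v) w - extm_br (extm_br u w) v.
Proof.
rewrite /extm_br !extm_tbrE !tbrE.
have pbr x y : p ⁅p x, p y⁆ = ⁅p x, p y⁆ by rewrite pK // lbr_ideall.
rewrite !pbr -linearB; apply/esym/extm_pi_eqP.
by rewrite -diff3E; apply: ideal_bound_diff; apply: Or31.
Qed.
HB.instance Definition _ :=
  isLeibniz.Build K (extm p) extm_linearl extm_linearr extm_leibniz.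

Definition extm_gen (x : star_gen A (fullp g)) : extm p :=
  match x with
  | Star1 a b => extm_pi (tens2 (val a) (val b))
  | Star2 b a => extm_pi (tens2 (val b) (val a))
  end.

(** The class of d (x ⊗ y ⊗ z) vanishes in the quotient. *)
Lemma extm_diff3 x y z : [\/ x \in A, y \in A | z \in A] ->
  extm_pi (tens2 x ⁅y, z⁆) =
  extm_pi (tens2 ⁅x, y⁆ z) - extm_pi (tens2 ⁅x, z⁆ y).
Proof.
move=> xyz; rewrite -(linearB extm_pi); apply/esym/extm_pi_eqP.
rewrite -diff3E.
exact: ideal_bound_diff.
Qed.

Lemma extm_lbr x y x' y' : ⁅x, y⁆ \in A -> ⁅x', y'⁆ \in A ->
  ⁅extm_pi (tens2 x y), extm_pi (tens2 x' y')⁆ = extm_pi (tens2 ⁅x, y⁆ ⁅x', y'⁆).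
Proof.
move=> xyA xyA'; rewrite -[LHS]/(extm_br _ _) /extm_br.
by rewrite !extm_tbrE !tbrE !pK.
Qed.

(** The first four relations are bilinearity of ⊗, the next six follow from [extm_diff3], and the
    eight on brackets of generators from [extm_lbr]. *)
Lemma extm_star s t : star_rel s t -> leval extm_gen s = leval extm_gen t.
Proof.
pose inA (a : subsp A) := valP a : val a \in A.
case=> /=.
- by move=> c a a' b; rewrite tens2_is_linearl linearP.
- by move=> c a b b'; rewrite !linearP.
- by move=> c b b' a; rewrite tens2_is_linearl linearP.
- by move=> c b a a'; rewrite !linearP.
- by move=> a b b'; rewrite scaleN1r extm_diff3 //; apply: Or31; apply: inA.
- by move=> b a a'; rewrite scaleN1r extm_diff3 //; apply: Or32; apply: inA.
- by move=> a a' b; rewrite scaleN1r extm_diff3 ?subKr //; apply: Or31; apply: inA.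
- by move=> b b' a; rewrite scaleN1r extm_diff3 ?subKr //; apply: Or32; apply: inA.
- by move=> a a' b; rewrite scaleN1r !extm_diff3 ?opprB //; apply: Or31; apply: inA.
- move=> b b' a; rewrite scaleN1r !extm_diff3 ?opprB //.
    by apply: Or32; apply: inA.
  by apply: Or33; apply: inA.
all: move=> a b a' b'; rewrite extm_lbr //;
  by [apply: lbr_ideall; apply: inA | apply: lbr_idealr; apply: inA].
Qed.

Definition extm_star_hom : {leibniz star A (fullp g) -> extm p} := llift extm_star.

(** Both symbols formed from c and c' go to the class of c ⊗ c'. *)
Lemma extm_ext w : w \in @ext_rel _ _ A (fullp g) -> extm_star_hom w = 0.
Proof.
move: w; apply: span_ind => [|c u v u0 v0|_ [c [c' ->]]]; first exact: linear0.
  by rewrite linearP /= u0 v0 scaler0 addr0.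
rewrite linearB /extm_star_hom /= !llift_gen; exact: subrr.
Qed.

Definition extm_of_ext : ext A (fullp g) -> extm p := vlift extm_ext.
HB.instance Definition _ := GRing.Linear.on extm_of_ext.

Lemma extm_of_ext1 a b : extm_of_ext (ext1 a b) = extm_pi (tens2 (val a) (val b)).
Proof. by rewrite /extm_of_ext vlift_pi /= llift_gen. Qed.
Lemma extm_of_ext2 b a : extm_of_ext (ext2 b a) = extm_pi (tens2 (val b) (val a)).
Proof. by rewrite /extm_of_ext vlift_pi /= llift_gen. Qed.

Definition to_ideal x : subsp A := exist _ (p x) (pA x).
Definition to_full x : subsp (fullp g) := exist _ x isT.
Lemma to_ideal_is_linear : linear to_ideal.
Proof. by move=> c x y; apply/val_inj; rewrite /= linearP. Qed.
Lemma to_full_is_linear : linear to_full.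
Proof. by move=> c x y; apply/val_inj. Qed.
HB.instance Definition _ := GRing.isLinear.Build K _ _ *:%R to_ideal to_ideal_is_linear.
HB.instance Definition _ := GRing.isLinear.Build K _ _ *:%R to_full to_full_is_linear.

Local Notation E1 := (@ext1 _ _ A (fullp g)).
Local Notation E2 := (@ext2 _ _ A (fullp g)).

Lemma ext1_is_linearl b : linear (E1^~ b).
Proof.
move=> c a a'; rewrite /ext1 -linearP; congr (vpi _ _).
by rewrite /star1 /lgen -lpiZ -lpiD; apply/lpi_eqP/lcong_rel/star1_linearl.
Qed.
Lemma ext1_is_linearr a : linear (E1 a).
Proof.
move=> c b b'; rewrite /ext1 -linearP; congr (vpi _ _).
by rewrite /star1 /lgen -lpiZ -lpiD; apply/lpi_eqP/lcong_rel/star1_linearr.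
Qed.
Lemma ext2_is_linearl a : linear (E2^~ a).
Proof.
move=> c b b'; rewrite /ext2 -linearP; congr (vpi _ _).
by rewrite /star2 /lgen -lpiZ -lpiD; apply/lpi_eqP/lcong_rel/star2_linearl.
Qed.
Lemma ext2_is_linearr b : linear (E2 b).
Proof.
move=> c a a'; rewrite /ext2 -linearP; congr (vpi _ _).
by rewrite /star2 /lgen -lpiZ -lpiD; apply/lpi_eqP/lcong_rel/star2_linearr.
Qed.

(** In x ⊗ y = p x ⊗ y + (x - p x) ⊗ p y + (x - p x) ⊗ (y - p y) the first two summands lie in N_2;
    the third is sent to 0. *)
Definition ext_of_pair x y :=
  E1 (to_ideal x) (to_full y) + E2 (to_full (x - p x)) (to_ideal y).
Lemma ext_of_pair_linearl y : linear (ext_of_pair^~ y).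
Proof.
move=> c x x'; rewrite /ext_of_pair linearP opprD addrACA -scalerBr !linearP.
by rewrite ext1_is_linearl ext2_is_linearl scalerDr addrACA.
Qed.
Lemma ext_of_pair_linearr x : linear (ext_of_pair x).
Proof.
move=> c y y'; rewrite /ext_of_pair !linearP.
by rewrite ext1_is_linearr ext2_is_linearr scalerDr addrACA.
Qed.
Definition ext_of_tens : tpow g 2 -> ext A (fullp g) :=
  tlift2 ext_of_pair_linearl ext_of_pair_linearr.
HB.instance Definition _ := GRing.Linear.on ext_of_tens.
Lemma ext_of_tensB t u : ext_of_tens (t - u) = ext_of_tens t - ext_of_tens u.
Proof. exact: linearB. Qed.
Lemma ext_of_tensE x y : ext_of_tens (tens2 x y) = ext_of_pair x y.
Proof. exact: tlift2E. Qed.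

(** This is the relation that cuts the exterior product out of the tensor product, as A ∩ g = A. *)
Lemma ext1_meet (a a' : subsp A) : E1 a (to_full (val a')) = E2 (to_full (val a)) a'.
Proof.
have meetA (c : subsp A) : val c \in meetp A (fullp g).
  by rewrite unfold_in /meetp (valP c).
apply/eqP; rewrite -subr_eq0 /ext1 /ext2 -linearB vpi_eq0; apply/mem_span.
exists (exist _ (val a) (meetA a)), (exist _ (val a') (meetA a')).
by congr (star1 _ _ - star2 _ _); apply/val_inj.
Qed.

Lemma to_ideal_val (a : subsp A) : to_ideal (val a) = a.
Proof. by apply/val_inj; rewrite /= pK //; apply: (valP a). Qed.

Lemma ext_of_tens_val1 (a : subsp A) y :
  ext_of_tens (tens2 (val a) y) = E1 a (to_full y).
Proof.
rewrite ext_of_tensE /ext_of_pair to_ideal_val pK ?subrr; last exact: (valP a).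
suff -> : E2 (to_full 0) (to_ideal y) = 0 by rewrite addr0.
rewrite -[X in to_full X](subrr 0) linearB.
by rewrite (zmod_morphism_linear (ext2_is_linearl _)) subrr.
Qed.

(** By [ext1_meet] the first summand p x ⋏ a may be read as a symbol of the second kind, and then
    the two summands add up. *)
Lemma ext_of_tens_val2 x (a : subsp A) :
  ext_of_tens (tens2 x (val a)) = E2 (to_full x) a.
Proof.
rewrite ext_of_tensE /ext_of_pair to_ideal_val ext1_meet linearB.
by rewrite (zmod_morphism_linear (ext2_is_linearl _)) addrC subrK.
Qed.

(** The span of these is N_2. *)
Definition tens2_ideal_gen (t : tpow g 2) :=
  exists x y, (x \in A \/ y \in A) /\ t = tens2 x y.
Definition tens2_ideal : {pred tpow g 2} := Defs.span tens2_ideal_gen.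
HB.instance Definition _ := GRing.SubmodClosed.on tens2_ideal.

Lemma mem_tens2_ideal x y : x \in A \/ y \in A -> tens2 x y \in tens2_ideal.
Proof. by move=> xy; apply: mem_span; exists x, y. Qed.

Lemma tens2_ideal_ind (Q : tpow g 2 -> Prop) :
  Q 0 -> (forall c u v, Q u -> Q v -> Q (c *: u + v)) ->
  (forall (a : subsp A) y, Q (tens2 (val a) y)) ->
  (forall x (a : subsp A), Q (tens2 x (val a))) ->
  forall t, t \in tens2_ideal -> Q t.
Proof.
move=> Q0 QD Q1 Q2; apply: span_ind => // _ [x [y [[xA|yA] ->]]].
  exact: (Q1 (exist _ x xA)).
exact: (Q2 _ (exist _ y yA)).
Qed.

(** Together with [ext_of_tens_bound] and [ext_of_tens_surj], this makes A ⋏ g isomorphic to N_2 / d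
    N_3. *)
Lemma extm_of_extK t : t \in tens2_ideal -> extm_of_ext (ext_of_tens t) = extm_pi t.
Proof.
move: t; apply: tens2_ideal_ind => [|c u v uE vE|a y|x a].
- by rewrite !linear0.
- by rewrite !linearP /= uE vE.
- by rewrite ext_of_tens_val1 extm_of_ext1.
- by rewrite ext_of_tens_val2 extm_of_ext2.
Qed.

(** Under that isomorphism theta becomes the differential, so its kernel consists of the classes of
    the 2-cycles in N_2. *)
Lemma theta_ext_of_tens t : t \in tens2_ideal ->
  val (theta A (fullp g) (ext_of_tens t)) = tbr t.
Proof.
move: t; apply: tens2_ideal_ind => [|c u v uE vE|a y|x a].
- by rewrite !linear0.
- by rewrite !linearP /= -uE -vE.
- by rewrite ext_of_tens_val1 theta_ext1 tbrE.
- by rewrite ext_of_tens_val2 theta_ext2 tbrE.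
Qed.

(** The position of the entry in A selects the relation: [star_1r] for the first, [star_2l] for the
    second, and for the third [star_2l] after [star_2N] has turned [y, a] into - [a, y]. *)
Lemma ext_of_tens_bound t : t \in ideal_bound -> ext_of_tens t = 0.
Proof.
move: t; apply: span_ind => [|c u v u0 v0|_ [x [y [z [xyz ->]]]]].
- exact: linear0.
- by rewrite linearP /= u0 v0 scaler0 addr0.
have br_full u v : to_full ⁅u, v⁆ = ⁅to_full u, to_full v⁆ by apply/val_inj.
rewrite diff3E !ext_of_tensB; apply/eqP; rewrite subr_eq0; apply/eqP.
case: xyz => [xA|yA|zA].
- pose a : subsp A := exist _ x xA.
  rewrite -[x]/(val a) -[⁅val a, y⁆]/(val (ibrl a y)) -[⁅val a, z⁆]/(val (ibrl a z)).
  rewrite !ext_of_tens_val1 br_full.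
  rewrite /ext1 -linearB; congr (vpi _ _); rewrite -lpiB.
  exact/esym/lpi_eqP/lcong_rel/(@star_1r _ _ _ _ a (to_full y) (to_full z)).
- pose a : subsp A := exist _ y yA.
  rewrite -[y]/(val a) -[⁅x, val a⁆]/(val (ibrr x a)) -[⁅val a, z⁆]/(val (ibrl a z)).
  rewrite ext_of_tens_val1 !ext_of_tens_val2 br_full.
  apply/eqP; rewrite subr_eq addrC -subr_eq; apply/eqP.
  rewrite /ext1 /ext2 -linearB; congr (vpi _ _); rewrite -lpiB.
  exact/esym/lpi_eqP/lcong_rel/(@star_2l _ _ _ _ (to_full x) (to_full z) a).
- pose a : subsp A := exist _ z zA.
  rewrite -[z]/(val a) -[⁅x, val a⁆]/(val (ibrr x a)) -[⁅y, val a⁆]/(val (ibrr y a)).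
  rewrite ext_of_tens_val1 !ext_of_tens_val2 br_full.
  have -> : E2 (to_full x) (ibrr y a) = - E2 (to_full x) (ibrl a y).
    rewrite /ext2 -linearN; congr (vpi _ _); rewrite -scaleN1r -lpiZ.
    exact/lpi_eqP/lcong_rel/(@star_2N _ _ _ _ (to_full x) (to_full y) a).
  apply/eqP; rewrite subr_eq addrC; apply/eqP.
  rewrite /ext1 /ext2 -linearB; congr (vpi _ _); rewrite -lpiB.
  exact/lpi_eqP/lcong_rel/(@star_2l _ _ _ _ (to_full x) (to_full y) a).
Qed.

Definition star_gen_val w :=
  exists a b, w = @star1 _ _ A (fullp g) a b \/ w = star2 b a.

(** The bracket of two generators is again a generator, so the generators span linearly. *)
Lemma star_span w : w \in Defs.span star_gen_val.
Proof.
have [s ->] := lpiP w; elim: s => [[a b|b a]||s IHs t IHt|c s IHs|s IHs t IHt].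
- by apply: mem_span; exists a, b; left.
- by apply: mem_span; exists a, b; right.
- by rewrite lpi0 rpred0.
- by rewrite lpiD rpredD.
- by rewrite lpiZ rpredZ.
rewrite lpi_br; move: (lpi _ s) IHs; apply: span_ind => [|c u v uS vS|x [a [b xE]]].
- by rewrite lbr0l rpred0.
- by rewrite lbrDl lbrZl rpredD ?rpredZ.
move: (lpi _ t) IHt; apply: span_ind => [|c u v uS vS|y [a' [b' yE]]].
- by rewrite lbr0r rpred0.
- by rewrite lbrDr lbrZr rpredD ?rpredZ.
apply: mem_span; case: xE yE => [->|->] [->|->];
  rewrite (star_br1, star_br12, star_br21, star_br2); do 2!eexists; left; reflexivity.
Qed.

Lemma ext_of_tens_surj w : exists2 t, t \in tens2_ideal & ext_of_tens t = w.
Proof.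
have [u ->] := vpiP w; move: u (star_span u).
apply: span_ind => [|c u v [t tI tu] [t' tI' tv]|_ [a [b [->|->]]]].
- by exists 0; rewrite ?rpred0 // !linear0.
- by exists (c *: t + t'); [rewrite rpredD ?rpredZ | rewrite !linearP /= tu tv].
- exists (tens2 (val a) (val b)).
    by apply: mem_tens2_ideal; left; apply: (valP a).
  by rewrite ext_of_tens_val1; congr E1; apply/val_inj.
- exists (tens2 (val b) (val a)).
    by apply: mem_tens2_ideal; right; apply: (valP a).
  by rewrite ext_of_tens_val2; congr E2; apply/val_inj.
Qed.

(** With [commp_tbr], [A, g] is the image of N_2 under the differential, whence H_1(N) = A /
    [A, g]. *)
Lemma tens2_ideal_tbr t : t \in tens2_ideal -> tbr t \in commp A (fullp g).
Proof.
move: t; apply: tens2_ideal_ind => [|c u v uE vE|a y|x a].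
- by rewrite linear0 rpred0.
- by rewrite linearP rpredD ?rpredZ.
- by rewrite tbrE; apply: mem_span; exists (val a), y; split; [exact: (valP a)| |left].
- by rewrite tbrE; apply: mem_span; exists (val a), x; split; [exact: (valP a)| |right].
Qed.

Lemma commp_tbr x : x \in commp A (fullp g) -> exists2 t, t \in tens2_ideal & tbr t = x.
Proof.
move: x; apply: span_ind => [|c u v [t tI tu] [t' tI' tv]|z [x [y [xA _ zE]]]].
- by exists 0; rewrite ?rpred0 ?linear0.
- by exists (c *: t + t'); [rewrite rpredD ?rpredZ | rewrite linearP /= tu tv].
case: zE => ->.
  by exists (tens2 x y); [apply: mem_tens2_ideal; left|rewrite tbrE].
by exists (tens2 y x); [apply: mem_tens2_ideal; right|rewrite tbrE].
Qed.

End Retract.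

(** * Homology classes and their representatives in low degrees *)

Definition in_subsp (K : fieldType) (V : lmodType K) (S : submodClosed V) x
  (xS : x \in S) : subsp S := exist _ x xS.

Section HomologyClasses.
Variables (K : fieldType) (n : nat).

Lemma cycle_classP (g : leibnizType K) (y : HL n g) : exists z, y = cycle_class z.
Proof. exact: vpiP. Qed.

Lemma cycle_class_eqP (g : leibnizType K) (z z' : cycles n g) :
  cycle_class z = cycle_class z' <-> exists w, ldiff g n.+1 w = val z - val z'.
Proof.
split=> [/vpi_eqP/asboolP[w wE]|[w wE]]; first by exists w; exact: wE.
by apply/vpi_eqP/asboolP; exists w; exact: wE.
Qed.

Lemma cycle_class_eq0 (g : leibnizType K) (z : cycles n g) :
  cycle_class z = 0 <-> exists w, ldiff g n.+1 w = val z.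
Proof.
split=> [|[w wE]].
  rewrite -[X in _ = X](linear0 cycle_class) => /cycle_class_eqP[w wE].
  by exists w; rewrite wE subr0.
rewrite -[RHS](linear0 cycle_class); apply/cycle_class_eqP; exists w.
by rewrite wE subr0.
Qed.

Lemma HL_mapE (g h : leibnizType K) (f : {leibniz g -> h}) (z : cycles n g) :
  HL_map n f (cycle_class z) = cycle_class (Defs.cycle_map f z).
Proof. by rewrite /HL_map vlift_pi. Qed.

End HomologyClasses.

Section LowDegreeClasses.
Variables (K : fieldType) (g : leibnizType K).

Lemma cycle2E t : (t \in lkern (ldiff g 2)) = (tbr t == 0).
Proof.
rewrite -[LHS]/(diff2 t == 0) diff2_tbr -(inj_eq (can_inj (@tens1K _ g)) (tbr t)).
by rewrite (linear0 (@tens1 K g)).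
Qed.
Lemma cycle3E t : (t \in lkern (ldiff g 3)) = (diff3 t == 0).
Proof. by []. Qed.
Lemma cycle1P t : t \in lkern (ldiff g 1).
Proof. by apply/eqP; apply: ldiff1_eq0. Qed.

Lemma cycle2_tbr (z : cycles 2 g) : tbr (val z) = 0.
Proof. by apply/eqP; rewrite -cycle2E (valP z). Qed.
Lemma cycle3_diff3 (z : cycles 3 g) : diff3 (val z) = 0.
Proof. by apply/eqP; rewrite -cycle3E (valP z). Qed.

Definition cycle1_of t : cycles 1 g := in_subsp (cycle1P t).
Definition cycle2_of t (t0 : tbr t = 0) : cycles 2 g :=
  in_subsp (etrans (cycle2E t) (introT eqP t0)).
Definition cycle3_of t (t0 : diff3 t = 0) : cycles 3 g :=
  in_subsp (etrans (cycle3E t) (introT eqP t0)).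

(** The general statements, restated with the convertible [diff2], [diff3] and [diff4]. *)
Lemma class1_eqP (z z' : cycles 1 g) :
  cycle_class z = cycle_class z' <-> exists w, diff2 w = val z - val z'.
Proof. exact: cycle_class_eqP. Qed.
Lemma class1_eq0 (z : cycles 1 g) : cycle_class z = 0 <-> exists w, diff2 w = val z.
Proof. exact: cycle_class_eq0. Qed.
Lemma class2_eqP (z z' : cycles 2 g) :
  cycle_class z = cycle_class z' <-> exists w, diff3 w = val z - val z'.
Proof. exact: cycle_class_eqP. Qed.
Lemma class2_eq0 (z : cycles 2 g) : cycle_class z = 0 <-> exists w, diff3 w = val z.
Proof. exact: cycle_class_eq0. Qed.

Lemma boundary2P (z : cycles 2 g) :
  z \in cycle_boundaries 2 g -> exists w, diff3 w = val z.
Proof. by move=> /asboolP. Qed.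
Lemma boundary3P (z : cycles 3 g) :
  z \in cycle_boundaries 3 g -> exists w, diff4 w = val z.
Proof. by move=> /asboolP. Qed.

End LowDegreeClasses.

Lemma tbr_map (K : fieldType) (g h : leibnizType K) (f : {leibniz g -> h}) t :
  tbr (tpow_map f t) = f (tbr t).
Proof.
apply: (tpow2_eq (f := fun u => tbr (tpow_map f u)) (f' := fun u => f (tbr u))).
- by apply: linear_comp_fun; apply: linearP.
- by apply: linear_comp_fun; apply: linearP.
by move=> x y; rewrite tpow_map2E !tbrE lbr_morph.
Qed.

(** * The exact sequence *)

Section ExactSequence.
Variables (K : fieldType) (a g h : leibnizType K).
Variables (i : {leibniz a -> g}) (tau : {leibniz g -> h}) (E : short_exact i tau).
Variable s : {linear h -> g}.
Hypothesis sK : cancel s tau.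

Local Notation A := (extp E).
Local Notation G := (fullp g).

Definition retract : g -> g := fun x => x - s (tau x).
Lemma retract_is_linear : linear retract.
Proof.
by move=> c x y; rewrite /retract (linearP tau) (linearP s) /= opprD addrACA -scalerBr.
Qed.
HB.instance Definition _ := GRing.isLinear.Build K g g *:%R retract retract_is_linear.

Lemma retract_in x : retract x \in A.
Proof. by rewrite extpE linearB /= sK subrr. Qed.
Lemma retract_id x : x \in A -> retract x = x.
Proof. by rewrite extpE /retract => /eqP->; rewrite linear0 subr0. Qed.

Lemma tpow_sK n : cancel (tpow_map s) (@tpow_map _ _ _ tau n).
Proof. exact: tpow_map_cancel. Qed.

Lemma tpow_map_retract_linear n :
  linear (fun t : tpow g n => t - tpow_map s (tpow_map tau t)).
Proof.
move=> c t u; rewrite (linearP (tpow_map tau)) (linearP (tpow_map s)) /=.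
by rewrite opprD addrACA -scalerBr.
Qed.

(** Replacing the entries one at a time writes the difference as a sum of tensors with an entry in
    A. *)
Lemma tens2_retract t : t - tpow_map s (tpow_map tau t) \in tens2_ideal A.
Proof.
apply: (tpow2_mem (f := fun u => u - tpow_map s (tpow_map tau u))) => [|x y].
  exact: tpow_map_retract_linear.
rewrite !tpow_map2E; set qx := s _; set qy := s _.
have -> : tens2 x y - tens2 qx qy = tens2 (x - qx) y + tens2 qx (y - qy).
  by rewrite tens2Bl tens2Br addrA subrK.
by apply: rpredD; apply: mem_tens2_ideal; [left|right]; apply: retract_in.
Qed.

Lemma tens2_ideal_tau t : t \in tens2_ideal A -> tpow_map tau t = 0.
Proof.
move: t; apply: span_ind => [|c u v u0 v0|_ [x [y [xyA ->]]]]; first exact: linear0.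
  by rewrite linearP /= u0 v0 scaler0 addr0.
rewrite tpow_map2E /=; case: xyA; rewrite extpE => /eqP->.
  by rewrite tens2_0l.
by rewrite tens2_0r.
Qed.

(** With [tens2_ideal_tau], N_2 is exactly the kernel of g ⊗ g -> h ⊗ h. *)
Lemma mem_ker_tau2 t : tpow_map tau t = 0 -> t \in tens2_ideal A.
Proof. by move=> t0; have := tens2_retract t; rewrite t0 linear0 subr0. Qed.

(** The same telescoping in degree 3: modulo d N_3, the differential of a 3-chain depends only on
    its image under tau. *)
Lemma ideal_bound_retract t :
  diff3 t - diff3 (tpow_map s (tpow_map tau t)) \in ideal_bound A.
Proof.
rewrite -diff3B.
apply: (tpow3_mem (f := fun u => diff3 (u - tpow_map s (tpow_map tau u)))) => [|x y z].
  by apply: linear_comp_fun; [apply: linearP|apply: tpow_map_retract_linear].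
rewrite !tpow_map3E; set qx := s _; set qy := s _; set qz := s _.
have -> : tens3 x y z - tens3 qx qy qz =
    tens3 (x - qx) y z + tens3 qx (y - qy) z + tens3 qx qy (z - qz).
  by rewrite tens3Bl tens3Bm tens3Br !addrA !subrK.
rewrite !diff3D; apply: rpredD; first apply: rpredD.
- by apply: ideal_bound_diff; apply: Or31; apply: retract_in.
- by apply: ideal_bound_diff; apply: Or32; apply: retract_in.
- by apply: ideal_bound_diff; apply: Or33; apply: retract_in.
Qed.

(** It provides corrections n that can be subtracted from a 3-chain of g without changing its image
    in h. *)
Lemma ideal_bound_lift u : u \in ideal_bound A ->
  exists2 n, tpow_map tau n = 0 & diff3 n = u.
Proof.
move: u; apply: span_ind => [|c u v [t tI tu] [t' tI' tv]|_ [x [y [z [xyz ->]]]]].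
- by exists 0; rewrite linear0.
- exists (c *: t + t'); first by rewrite linearP /= tI tI' scaler0 addr0.
  by rewrite diff3_is_linear tu tv.
exists (tens3 x y z) => //; rewrite tpow_map3E /=.
case: xyz; rewrite extpE => /eqP->.
- by rewrite tens3_0l.
- by rewrite tens3_0m.
- by rewrite tens3_0r.
Qed.

(** * The connecting maps, and the maps from Ker theta and a / [a, g] to the homology of g *)

Local Notation Pi := (extm_pi A retract).
Local Notation Phi := (extm_of_ext retract_in retract_id).
Local Notation Psi := (ext_of_tens retract_in).
Local Notation Theta := (theta A G).

Lemma diff3_lift (z : cycles 3 h) : diff3 (tpow_map s (val z)) \in tens2_ideal A.
Proof. by apply: mem_ker_tau2; rewrite tpow_map_diff3 tpow_sK cycle3_diff3. Qed.

Lemma d2_subproof (z : cycles 2 h) : tbr (tpow_map s (val z)) \in A.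
Proof. by rewrite extpE -tbr_map tpow_sK cycle2_tbr. Qed.
Definition d2_cycle (z : cycles 2 h) : commquo A G :=
  vpi (@commp_in _ _ A G) (in_subsp (d2_subproof z)).
Lemma d2_cycle_is_linear : linear d2_cycle.
Proof.
move=> c z z'; rewrite /d2_cycle -(linearP (vpi (@commp_in _ _ A G))); congr (vpi _ _).
by apply/val_inj; rewrite /= !linearP.
Qed.
HB.instance Definition _ := GRing.isLinear.Build K _ _ *:%R d2_cycle d2_cycle_is_linear.

Lemma d2_boundary z : z \in cycle_boundaries 2 h -> d2_cycle z = 0.
Proof.
move=> /boundary2P[w wz]; apply/eqP; rewrite /d2_cycle vpi_eq0 unfold_in /lpreim /=.
set t := tpow_map s (val z).
(* The section s need not preserve brackets, but s z and d (s w) both lift z = d w, so they differ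
   by an element of N_2. *)
have : t - diff3 (tpow_map s w) \in tens2_ideal A.
  by apply: mem_ker_tau2; rewrite tpow_mapB tpow_map_diff3 !tpow_sK wz subrr.
by move/tens2_ideal_tbr; rewrite tbrB tbr_diff3 subr0.
Qed.
Definition d2 : HL 2 h -> commquo A G := vlift d2_boundary.
HB.instance Definition _ := GRing.Linear.on d2.

Lemma d3_subproof (z : cycles 3 h) : Psi (diff3 (tpow_map s (val z))) \in lkern Theta.
Proof.
apply/eqP/val_inj; rewrite theta_ext_of_tens ?tbr_diff3 //; first exact: retract_id.
exact: diff3_lift.
Qed.
Definition d3_cycle (z : cycles 3 h) : ker Theta := in_subsp (d3_subproof z).
Lemma d3_cycle_is_linear : linear d3_cycle.
Proof.
move=> c z z'; apply/val_inj; rewrite /= (linearP (tpow_map s)) /=.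
by rewrite diff3_is_linear (linearP Psi).
Qed.
HB.instance Definition _ := GRing.isLinear.Build K _ _ *:%R d3_cycle d3_cycle_is_linear.

(** Any lift of a cycle, not only the one given by s, may thus be used to compute [d3]. *)
Lemma ext_of_tens_diff3_retract t :
  Psi (diff3 (tpow_map s (tpow_map tau t))) = Psi (diff3 t).
Proof.
apply/eqP; rewrite eq_sym -subr_eq0 -ext_of_tensB; apply/eqP.
by apply: ext_of_tens_bound; [apply: retract_id|apply: ideal_bound_retract].
Qed.

Lemma d3_boundary z : z \in cycle_boundaries 3 h -> d3_cycle z = 0.
Proof.
move=> /boundary3P[w wz]; apply/val_inj => /=.
(* The chain d (s w) is another lift of z = d w, and its differential is 0. *)
have -> : val z = tpow_map tau (diff4 (tpow_map s w)).
  by rewrite tpow_map_diff4 tpow_sK.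
by rewrite ext_of_tens_diff3_retract diff3_diff4 linear0.
Qed.
Definition d3 : HL 3 h -> ker Theta := vlift d3_boundary.
HB.instance Definition _ := GRing.Linear.on d3.

Definition e2_rep (w : ker Theta) : tpow g 2 :=
  repr (Phi (val w) : vquot (ideal_bound A)).

Lemma e2_rep_pi w : Pi (e2_rep w) = Phi (val w).
Proof. exact: vpi_repr. Qed.

(** The bracket of a representative is theta of w, as is seen on a preimage of w in N_2. *)
Lemma e2_subproof (w : ker Theta) : tbr (e2_rep w) = 0.
Proof.
have [t tA tw] := ext_of_tens_surj retract_in retract_id (val w).
rewrite -(extm_tbrE A retract) e2_rep_pi -tw extm_of_extK // extm_tbrE.
rewrite -(theta_ext_of_tens retract_in retract_id) // tw.
by have /eqP-> := valP w.
Qed.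
Definition e2 (w : ker Theta) : HL 2 g := cycle_class (cycle2_of (e2_subproof w)).

(** Representatives differ by elements of d N_3, which are boundaries in g; so [e2] does not depend
    on the choice made by [repr]. *)
Lemma e2E (w : ker Theta) (z : cycles 2 g) :
  Phi (val w) = Pi (val z) -> e2 w = cycle_class z.
Proof.
rewrite -e2_rep_pi => /extm_pi_eqP/ideal_bound_lift[n _ nE]; apply/class2_eqP.
by exists n.
Qed.

Lemma e2_is_linear : linear e2.
Proof.
move=> c w w'; rewrite -(linearP cycle_class); apply: e2E.
by rewrite /= (linearP Phi) (linearP Pi) /= -!e2_rep_pi.
Qed.
HB.instance Definition _ := GRing.isLinear.Build K _ _ *:%R e2 e2_is_linear.

Definition e1_elt (x : subsp A) : HL 1 g := cycle_class (cycle1_of (tens1 (val x))).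
Lemma e1_elt_is_linear : linear e1_elt.
Proof.
move=> c x y; rewrite /e1_elt -(linearP cycle_class); congr cycle_class.
by apply/val_inj; rewrite /= !linearP.
Qed.
HB.instance Definition _ := GRing.isLinear.Build K _ _ *:%R e1_elt e1_elt_is_linear.

Lemma e1_comm x : x \in @commp_in _ _ A G -> e1_elt x = 0.
Proof.
move=> /commp_tbr[t _ tx]; apply/class1_eq0; exists t.
by rewrite diff2_tbr tx.
Qed.
Definition e1 : commquo A G -> HL 1 g := vlift e1_comm.
HB.instance Definition _ := GRing.Linear.on e1.

(** * Exactness at each term *)

Lemma d3E z : d3 (cycle_class z) = d3_cycle z. Proof. exact: vlift_pi. Qed.
Lemma d2E z : d2 (cycle_class z) = d2_cycle z. Proof. exact: vlift_pi. Qed.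
Lemma e1E x : e1 (vpi _ x) = e1_elt x. Proof. exact: vlift_pi. Qed.

Lemma exact_HL3h : exact_at (HL_map 3 tau) d3.
Proof.
move=> y; have [z ->] := cycle_classP y; rewrite d3E; split.
  move/(congr1 val) => /= z0; set t := tpow_map s (val z) in z0.
  have tA : diff3 t \in tens2_ideal A by apply: diff3_lift.
  have := extm_of_extK retract_in retract_id tA.
  rewrite z0 linear0 -[X in X = _ -> _](linear0 Pi).
  (* Here d (s z) = d n with n killed by tau, so s z - n is a cycle that still lifts z. *)
  move=> /esym/extm_pi_eqP; rewrite subr0 => /ideal_bound_lift[n n0 nE].
  have tnK : diff3 (t - n) = 0 by rewrite diff3B nE subrr.
  exists (cycle_class (cycle3_of tnK)); rewrite HL_mapE; congr cycle_class.
  by apply/val_inj; rewrite /= tpow_mapB n0 subr0 tpow_sK.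
case=> x; have [u ->] := cycle_classP x; rewrite HL_mapE => uz.
(* The chain u lifts a cycle homologous to z, and d u = 0. *)
rewrite -d3E -uz d3E; apply/val_inj; rewrite /= ext_of_tens_diff3_retract.
by rewrite cycle3_diff3 linear0.
Qed.

Lemma exact_ker_theta : exact_at d3 e2.
Proof.
move=> w; split=> [/class2_eq0[x /= xE]|[y <-]]; last first.
  have [z ->] := cycle_classP y; rewrite d3E.
  have tK : tbr (diff3 (tpow_map s (val z))) = 0.
    by rewrite tbr_diff3.
  (* The image under [e2] may be computed from the representative d (s z), a boundary. *)
  rewrite (@e2E _ (cycle2_of tK)).
    by apply/class2_eq0; exists (tpow_map s (val z)).
  by rewrite extm_of_extK //; apply: diff3_lift.
have [t tA tw] := ext_of_tens_surj retract_in retract_id (val w).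
have tE : Pi t = Pi (diff3 x) by rewrite xE e2_rep_pi -tw extm_of_extK.
(* The element w is represented by t in N_2 and by the boundary d x; so t = d (x + n), and x + n
   maps to a cycle of h. *)
have /ideal_bound_lift[n n0 nE] : t - diff3 x \in ideal_bound A.
  by apply/(extm_pi_eqP A retract).
have xn : t = diff3 (x + n) by rewrite diff3D nE addrC subrK.
have yK : diff3 (tpow_map tau (x + n)) = 0.
  by rewrite -tpow_map_diff3 -xn tens2_ideal_tau.
exists (cycle_class (cycle3_of yK)); rewrite d3E; apply/val_inj => /=.
by rewrite ext_of_tens_diff3_retract -xn.
Qed.

Lemma exact_HL2g : exact_at e2 (HL_map 2 tau).
Proof.
move=> y; have [z ->] := cycle_classP y; split; rewrite ?HL_mapE.
  move=> /class2_eq0[w /= wz].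
  (* As tau z = d w, subtracting d (s w) moves z into N_2 within its homology class. *)
  set t := val z - diff3 (tpow_map s w).
  have tA : t \in tens2_ideal A.
    by apply: mem_ker_tau2; rewrite tpow_mapB tpow_map_diff3 tpow_sK wz subrr.
  have t0 : tbr t = 0 by rewrite tbrB tbr_diff3 subr0 cycle2_tbr.
  have tK : Psi t \in lkern Theta.
    by apply/eqP/val_inj; rewrite theta_ext_of_tens ?t0 //; exact: retract_id.
  exists (in_subsp tK).
  rewrite (@e2E _ (cycle2_of t0)) ?extm_of_extK //; apply/class2_eqP.
  by exists (- tpow_map s w); rewrite diff3N /= /t addrAC subrr add0r.
(* The representative of [e2 w] lies in N_2, so tau kills it already as a chain, and 0 bounds its
   image. *)
case=> w wz; rewrite -HL_mapE -wz HL_mapE; apply/class2_eq0; exists 0.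
rewrite linear0 /=; apply/esym.
have [t tA tw] := ext_of_tens_surj retract_in retract_id (val w).
have /ideal_bound_lift[n n0 nE] : e2_rep w - t \in ideal_bound A.
  by apply/(extm_pi_eqP A retract); rewrite e2_rep_pi -tw extm_of_extK.
have -> : e2_rep w = diff3 n + t by rewrite nE subrK.
by rewrite linearD /= tpow_map_diff3 n0 linear0 add0r tens2_ideal_tau.
Qed.

Lemma exact_HL2h : exact_at (HL_map 2 tau) d2.
Proof.
move=> y; have [z ->] := cycle_classP y; split.
  rewrite d2E /d2_cycle => /eqP; rewrite vpi_eq0 => /commp_tbr[t tA /= tE].
  (* The chain t in N_2 has the same bracket as s z, so s z - t is a cycle that still lifts z. *)
  have tK : tbr (tpow_map s (val z) - t) = 0.
    by rewrite tbrB tE subrr.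
  exists (cycle_class (cycle2_of tK)); rewrite HL_mapE; congr cycle_class.
  by apply/val_inj; rewrite /= tpow_mapB tpow_sK tens2_ideal_tau ?subr0.
case=> x; have [u ->] := cycle_classP x; rewrite HL_mapE => <-.
rewrite d2E; apply/eqP; rewrite /d2_cycle vpi_eq0 unfold_in /lpreim /=.
(* The cycle u and s (tau u) differ by an element of N_2, so the bracket of s (tau u) lies in
   [A, g]. *)
have := tens2_ideal_tbr (tens2_retract (val u)).
by rewrite tbrB cycle2_tbr sub0r => /submod_rpredN; rewrite opprK.
Qed.

Lemma exact_commquo : exact_at d2 e1.
Proof.
move=> y; have [x ->] := vpiP y; rewrite e1E; split.
  move=> /class1_eq0[t /= tE].
  have tx : tbr t = val x by rewrite /tbr tE tens1K.
  (* A chain t bounding x maps to a cycle of h, and the bracket of s (tau t) agrees with x modulo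
     [A, g]. *)
  have tK : tbr (tpow_map tau t) = 0.
    by rewrite tbr_map tx; apply/eqP; rewrite -(extpE E) (valP x).
  exists (cycle_class (cycle2_of tK)); rewrite d2E.
  apply/vpi_eqP; rewrite unfold_in /lpreim /= -tx.
  have := tens2_ideal_tbr (tens2_retract t); rewrite tbrB.
  by move/submod_rpredN; rewrite opprB.
case=> u; have [z ->] := cycle_classP u; rewrite d2E -e1E => <-; rewrite e1E.
by apply/class1_eq0; exists (tpow_map s (val z)); rewrite diff2_tbr.
Qed.

Lemma exact_HL1g : exact_at e1 (HL_map 1 tau).
Proof.
move=> y; have [z ->] := cycle_classP y; split; rewrite ?HL_mapE.
  move=> /class1_eq0[w /= wz].
  (* Subtracting this boundary moves z into A, since tau z = d w. *)
  set t := diff2 (tpow_map s w).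
  have xA : untens1 (val z - t) \in A.
    rewrite extpE -(inj_eq (can_inj (@tens1K _ h))) -tpow_map1E untens1K.
    by rewrite tpow_mapB tpow_map_diff2 tpow_sK wz subrr linear0.
  exists (vpi _ (in_subsp xA)); rewrite e1E; apply/class1_eqP.
  by exists (- tpow_map s w); rewrite diff2N /= untens1K addrAC subrr add0r.
case=> u; have [x ->] := vpiP u; rewrite e1E => xz.
rewrite -HL_mapE -xz HL_mapE; apply/class1_eq0; exists 0; rewrite linear0 /=.
by rewrite tpow_map1E; have := valP x; rewrite extpE => /eqP /= ->; rewrite linear0.
Qed.

(** Every 1-chain is a cycle, so s lifts cycles to cycles in degree 1. *)
Lemma HL1_surj (y : HL 1 h) : exists x : HL 1 g, HL_map 1 tau x = y.
Proof.
have [z ->] := cycle_classP y.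
exists (cycle_class (cycle1_of (tpow_map s (val z)))).
by rewrite HL_mapE; congr cycle_class; apply/val_inj; rewrite /= tpow_sK.
Qed.

End ExactSequence.

Theorem proposition4p3 (K : fieldType) (a g h : leibnizType K)
    (i : {leibniz a -> g}) (tau : {leibniz g -> h}) (E : short_exact i tau) :
  exists (d3 : {linear HL 3 h -> ker (theta (extp E) (fullp g))})
         (e2 : {linear ker (theta (extp E) (fullp g)) -> HL 2 g})
         (d2 : {linear HL 2 h -> commquo (extp E) (fullp g)})
         (e1 : {linear commquo (extp E) (fullp g) -> HL 1 g}),
    exact_at (HL_map 3 tau) d3 /\
    exact_at d3 e2 /\
    exact_at e2 (HL_map 2 tau) /\
    exact_at (HL_map 2 tau) d2 /\
    exact_at d2 e1 /\
    exact_at e1 (HL_map 1 tau) /\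
    (forall y : HL 1 h, exists x : HL 1 g, HL_map 1 tau x = y).
Proof.
have [s sK] := linear_section (se_surj E).
exists (d3 E sK), (e2 (E:=E) sK), (d2 E sK), (e1 (E:=E)).
split; first exact: exact_HL3h.
split; first exact: exact_ker_theta.
split; first exact: exact_HL2g.
split; first exact: exact_HL2h.
split; first exact: exact_commquo.
split; first exact: (exact_HL1g E sK).
exact: (HL1_surj sK).
Qed.
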